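(* Let $n$ be a positive integer. With the notation of the context, the roots of the polynomials $K(x), L(x), M(x)$ and the eigenspaces of $A_{Q_n}, A_{\hat{Q}_n}, A_{\hat{\hat{Q}}_n}$ are related as follows. (i) All three polynomials $K(x), L(x), M(x)$ have only simple roots, which are real and symmetric about $0$ in $\mathbb{R}$. (ii) The roots of $K(x)$ are the same as the eigenvalues of $A_{Q_n}$, namely $\{-n,-(n-2),\ldots,n-2,n\}$. (iii) The roots of $L(x)$ strictly interlace the roots of $K(x)$. (iv) The roots of $M(x)$ strictly interlace the roots of $L(x)$. (v) The positive (resp. negative) roots of $M(x)$ strictly interlace the positive (resp. negative) roots of $K(x)$. (vi) For each $1\le k\le n-1$, the matrices $A_{\hat{Q}_n}$ and $A_{\hat{\hat{Q}}_n}$ have the common $(n-2k)$-eigen-subspace $\hat{\hat{V}}_{n-2k}$ (that is, $\hat{\hat{V}}_{n-2k}\subseteq\hat{\hat{V}}\subseteq\hat V$ and both operators act on it as the scalar $n-2k$), and the $S_n$-action on $\hat{\hat{V}}_{n-2k}$ is the permutation action on the $k$-subsets of $\{1,2,\ldots,n\}$ with the trivial representation removed (that is, the direct sum of $\hat{\hat{V}}_{n-2k}$ with the one-dimensional trivial representation is isomorphic to the real permutation representation on $k$-subsets). (vii) The matrices $A_{\hat{Q}_n}$ and $A_{\hat{\hat{Q}}_n}$ have, in addition to the subspaces in (vi), one-dimensional eigen-subspaces with trivial $S_n$-action, one for each root of the characteristic polynomial $L(x)$, respectively $M(x)$ (with eigenvalue that root). When $n$ is even, the root $0$ of $M(x)$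 coincides with $n-2(n/2)$, so that the $0$-eigenspace of $A_{\hat{\hat{Q}}_n}$ is the direct sum of $\hat{\hat{V}}_0$ and the one-dimensional $0$-eigen-subspace arising from the root $0$ of $M(x)$.
   Context: Let $\mathbb{Z}_2=\{0,1\}$. The hypercube graph $Q_n$ has vertex set $\mathbb{Z}_2^n$, with $u,v$ adjacent iff the Hamming distance $d(u,v)=\#\{i:u_i\ne v_i\}$ equals $1$. Let $\mathbf{0}_n=(0,\dots,0)$, $\mathbf{1}_n=(1,\dots,1)$. The graph $\hat{Q}_n$ is obtained from $Q_n$ by deleting the vertex $\mathbf{0}_n$, and $\hat{\hat{Q}}_n$ by deleting both $\mathbf{0}_n$ and $\mathbf{1}_n$. The Hamming weight is $\omega(u)=\#\{i:u_i=1\}$. Let $V=\mathbb{R}^{\mathbb{Z}_2^n}$ with standard basis $\{\mathbf{e}_u\}_{u\in\mathbb{Z}_2^n}$; let $\hat V\subset V$ be the subspace of vectors whose $\mathbf{0}_n$-coordinate vanishes, and $\hat{\hat V}\subset\hat V$ the subspace of vectors whose $\mathbf{0}_n$- and $\mathbf{1}_n$-coordinates both vanish. The $\{0,1\}$-adjacency matrices $A_{Q_n}, A_{\hat Q_n}, A_{\hat{\hat Q}_n}$ are viewed as linear operators on $V,\hat V,\hat{\hat V}$ respectively, each sending $\mathbf{e}_u$ (for $u$ a vertex of the graph) to $\sum_w \mathbf{e}_w$ over the vertices $w$ of that graph with $d(u,w)=1$. The symmetric group $S_n$ acts on $\mathbb{Z}_2^n$ by $\sigma(u_1,\dots,u_n)=(u_{\sigma^{-1}(1)},\dots,u_{\sigma^{-1}(n)})$,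 and correspondingly acts linearly on $V,\hat V,\hat{\hat V}$ by $\sigma(\mathbf{e}_u)=\mathbf{e}_{\sigma(u)}$. For $u\in\mathbb{Z}_2^n$ let $E_u\in V$ have coordinates $(E_u)_v=(-1)^{u\cdot v}$, where $u\cdot v=\sum_i u_iv_i\in\mathbb{Z}_2$. For $0\le k\le n$ define $\hat{\hat V}_{n-2k}=\operatorname{span}_{\mathbb{R}}\{E_u-E_v: u,v\in\mathbb{Z}_2^n,\ \omega(u)=\omega(v)=k\}$. Let $K$ be the $(n+1)\times(n+1)$ tridiagonal matrix, with rows and columns indexed by $0,1,\dots,n$, whose nonzero entries are exactly $K_{k,k+1}=n-k$ and $K_{k+1,k}=k+1$ for $0\le k\le n-1$. Let $L$ be the $n\times n$ principal submatrix of $K$ obtained by removing the first row and column, and $M$ the $(n-1)\times(n-1)$ principal submatrix obtained from $L$ by further removing the last row and column. Let $K(x)=\det(xI-K)$, $L(x)=\det(xI-L)$, $M(x)=\det(xI-M)$ be their characteristic polynomials (with the $0\times0$ determinant equal to $1$). With $e_k\in V$ defined by $(e_k)_v=1$ if $\omega(v)=k$ and $0$ otherwise, $K$ is the matrix of $A_{Q_n}$ acting on $U=\operatorname{span}_{\mathbb{R}}\{e_0,\dots,e_n\}$, $L$ is the matrix of $A_{\hat Q_n}$ acting on $\hat U=\operatorname{span}_{\mathbb{R}}\{e_1,\dots,e_n\}$, and $M$ is the matrix of $A_{\hat{\hat Q}_n}$ acting on $\hat{\hat U}=\operatorname{span}_{\mathbb{R}}\{e_1,\dots,e_{n-1}\}$,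 in these ordered bases. The eigen-subspace ''arising from'' a root of $L(x)$ (resp. $M(x)$) is the corresponding eigenspace of $A_{\hat Q_n}$ restricted to $\hat U$ (resp. $A_{\hat{\hat Q}_n}$ restricted to $\hat{\hat U}$). A finite set of reals $b_1<\dots<b_{r-1}$ strictly interlaces $a_1<\dots<a_r$ if $a_1<b_1<a_2<b_2<\cdots<b_{r-1}<a_r$. *)

(* Defs.v *)
From HB Require Import structures.
From mathcomp Require Import all_boot all_order all_algebra all_fingroup.
From mathcomp Require Import reals.
From mathcomp Require Import complex.

Set Implicit Arguments.
Unset Strict Implicit.
Unset Printing Implicit Defensive.

Import Order.TTheory GRing.Theory Num.Theory.
Local Open Scope ring_scope.

Notation cube n := 'rV['Z_2]_n.

Definition zerov n : cube n := const_mx 0.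
Definition onev n : cube n := const_mx 1.

Definition hdist n (u v : cube n) : nat := #|[set i | u 0 i != v 0 i]|.

Definition weight n (u : cube n) : nat := #|[set i | u 0 i == 1]|.

Definition dotZ2 n (u v : cube n) : 'Z_2 := \sum_i u 0 i * v 0 i.

(* Vertex sets of the three graphs; each graph is the subgraph of the
   hypercube induced on its vertex set. *)
Definition Q n : {set cube n} := [set: cube n].
Definition hQ n : {set cube n} := Q n :\ zerov n.
Definition hhQ n : {set cube n} := hQ n :\ onev n.

Notation Vcube R n := {ffun cube n -> R^o}.

Definition basis_vec (R : realType) n (u : cube n) : Vcube R n :=
  [ffun v => (v == u)%:R].

Definition coord_at (R : realType) n (u : cube n) (f : Vcube R n) : R^o := f u.

Lemma coord_at_linear (R : realType) n (u : cube n) :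
  linear (@coord_at R n u).
Proof. by move=> a f g; rewrite /coord_at !ffunE. Qed.

HB.instance Definition _ (R : realType) n (u : cube n) :=
  GRing.isLinear.Build R (Vcube R n) R^o *:%R (@coord_at R n u)
    (@coord_at_linear R n u).

Definition hV (R : realType) n : {vspace Vcube R n} :=
  lker (linfun (@coord_at R n (zerov n))).
Definition hhV (R : realType) n : {vspace Vcube R n} :=
  (hV R n :&: lker (linfun (@coord_at R n (onev n))))%VS.

Lemma memhV (R : realType) n (f : Vcube R n) :
  (f \in hV R n) = (f (zerov n) == 0).
Proof. by rewrite memv_ker lfunE. Qed.

Lemma memhhV (R : realType) n (f : Vcube R n) :
  (f \in hhV R n) = (f (zerov n) == 0) && (f (onev n) == 0).
Proof. by rewrite memv_cap memhV memv_ker lfunE. Qed.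

Definition adj_fun (R : realType) n (S : {set cube n}) (f : Vcube R n) :
    Vcube R n :=
  \sum_(u in S) f u *: \sum_(w in S | hdist u w == 1%N) basis_vec R w.

Lemma adj_fun_linear (R : realType) n (S : {set cube n}) :
  linear (@adj_fun R n S).
Proof.
move=> a f g; rewrite /adj_fun scaler_sumr -big_split /=.
by apply: eq_bigr => u _; rewrite !ffunE scalerDl scalerA.
Qed.

HB.instance Definition _ (R : realType) n (S : {set cube n}) :=
  GRing.isLinear.Build R (Vcube R n) (Vcube R n) *:%R (@adj_fun R n S)
    (@adj_fun_linear R n S).

(* The adjacency operator of the induced subgraph on S, extended by 0 on the
   basis vectors outside S so that the three operators live on the same space.
   Only its restriction to the span of the basis vectors of S is meaningful,
   so for S = hQ n (resp. hhQ n) eigenspaces are intersected with hV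
   (resp. hhV). *)
Definition adj (R : realType) n (S : {set cube n}) : 'End(Vcube R n) :=
  linfun (@adj_fun R n S).

Lemma adj_basis (R : realType) n (S : {set cube n}) (u : cube n) : u \in S ->
  adj R S (basis_vec R u) =
  \sum_(w in S | hdist u w == 1%N) basis_vec R w.
Proof.
move=> uS; rewrite lfunE /= /adj_fun (bigD1 u) //= ffunE eqxx scale1r.
rewrite [X in _ + X]big1 ?addr0 // => v /andP[_ vu].
by rewrite ffunE (negPf vu) scale0r.
Qed.

Lemma adj_stable (R : realType) n (S : {set cube n}) (f : Vcube R n)
  (w : cube n) : w \notin S -> adj R S f w = 0.
Proof.
move=> wS; rewrite lfunE /= /adj_fun sum_ffunE big1 // => u _.
rewrite ffunE sum_ffunE big1 ?scaler0 // => v /andP[vS _].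
by rewrite ffunE; case: eqP => // wv; rewrite wv vS in wS.
Qed.

(* (s1 * s2)%g is "first s1, then s2" in MathComp, so this left action
   satisfies cube_act (s1 * s2) u = cube_act s2 (cube_act s1 u). *)
Definition cube_act n (s : 'S_n) (u : cube n) : cube n :=
  \row_i u 0 ((s^-1)%g i).

Definition space_act (R : realType) n (s : 'S_n) (f : Vcube R n) : Vcube R n :=
  \sum_u f u *: basis_vec R (cube_act s u).

Lemma space_act_basis (R : realType) n (s : 'S_n) (u : cube n) :
  space_act s (basis_vec R u) = basis_vec R (cube_act s u).
Proof.
rewrite /space_act (bigD1 u) //= ffunE eqxx scale1r.
rewrite big1 ?addr0 // => v vu.
by rewrite ffunE (negPf vu) scale0r.
Qed.

Definition E (R : realType) n (u : cube n) : Vcube R n :=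
  [ffun v => (-1) ^+ (dotZ2 u v : nat)].

(* The space written with index n - 2 k in the mathematics. *)
Definition hhVk (R : realType) n (k : nat) : {vspace Vcube R n} :=
  <<[seq E R u - E R v | u <- enum [pred u : cube n | weight u == k],
                         v <- enum [pred v : cube n | weight v == k]]>>%VS.

Definition Kmx (R : realType) n : 'M[R]_n.+1 :=
  \matrix_(i, j) if j == i.+1 :> nat then (n - i)%:R
                 else if i == j.+1 :> nat then i%:R else 0.
Definition Lmx (R : realType) n : 'M[R]_n :=
  mxsub (lift ord0) (lift ord0) (Kmx R n).
Definition Mmx (R : realType) n : 'M[R]_n.-1 :=
  mxsub (widen_ord (leq_pred n)) (widen_ord (leq_pred n)) (Lmx R n).

Definition Kpoly (R : realType) n : {poly R} := char_poly (Kmx R n).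
Definition Lpoly (R : realType) n : {poly R} := char_poly (Lmx R n).
Definition Mpoly (R : realType) n : {poly R} := char_poly (Mmx R n).

Definition weight_vec (R : realType) n (k : nat) : Vcube R n :=
  [ffun v => (weight v == k)%:R].

Definition hU (R : realType) n : {vspace Vcube R n} :=
  <<[seq weight_vec R n k | k <- iota 1 n]>>%VS.
Definition hhU (R : realType) n : {vspace Vcube R n} :=
  <<[seq weight_vec R n k | k <- iota 1 n.-1]>>%VS.

Definition L_eigenspace (R : realType) n (x : R) : {vspace Vcube R n} :=
  (passmx.leigenspace (adj R (hQ n)) x :&: hU R n)%VS.
Definition M_eigenspace (R : realType) n (x : R) : {vspace Vcube R n} :=
  (passmx.leigenspace (adj R (hhQ n)) x :&: hhU R n)%VS.

(* Roots are taken in the complex numbers R[i]. *)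
Definition simple_real_symmetric_roots (R : realType) (p : {poly R}) : Prop :=
  let pC := map_poly (real_complex R) p in
  forall z : R[i], root pC z ->
    [/\ mup z pC = 1%N, z \is Num.real & root pC (- z)].

(* B strictly interlaces A; a and b list A and B in increasing order. *)
Definition strictly_interlaces (R : realType) (B A : pred R) : Prop :=
  exists a b : seq R,
    [/\ sorted <%R a /\ sorted <%R b, a =i A, b =i B, size a = (size b).+1
      & forall i : nat, (i < size b)%N -> a`_i < b`_i < a`_i.+1].

Definition act_stable (R : realType) n (W : {vspace Vcube R n}) : Prop :=
  forall (s : 'S_n) (f : Vcube R n), f \in W -> space_act s f \in W.

Definition act_trivial (R : realType) n (W : {vspace Vcube R n}) : Prop :=
  forall (s : 'S_n) (f : Vcube R n), f \in W -> space_act s f = f.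

(* The projection vsproj W is the identity on W, so this is the restricted
   action whenever act_stable W holds. *)
Definition sub_act (R : realType) n (W : {vspace Vcube R n}) (s : 'S_n)
    (f : subvs_of W) : subvs_of W :=
  vsproj W (space_act s (vsval f)).

Definition add_triv_act (R : realType) n (U : lmodType R)
    (r : 'S_n -> U -> U) (s : 'S_n) (x : U * R^o) : U * R^o :=
  (r s x.1, x.2).

Notation ksubset n k := {A : {set 'I_n} | #|A| == k}.

Lemma card_ksubset_act n (k : nat) (s : 'S_n) (A : ksubset n k) :
  #|s @: val A| == k.
Proof. by rewrite card_imset ?(valP A) //; apply: perm_inj. Qed.

Definition ksubset_act n (k : nat) (s : 'S_n) (A : ksubset n k) : ksubset n k :=
  exist _ (s @: val A) (card_ksubset_act s A).

Definition ksubset_perm_act (R : realType) n (k : nat) (s : 'S_n)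
    (f : {ffun ksubset n k -> R^o}) : {ffun ksubset n k -> R^o} :=
  \sum_A f A *: [ffun B => (B == ksubset_act s A)%:R].

Definition rep_iso (R : realType) n (U1 U2 : lmodType R)
    (r1 : 'S_n -> U1 -> U1) (r2 : 'S_n -> U2 -> U2) : Prop :=
  exists f : {linear U1 -> U2},
    bijective f /\ forall (s : 'S_n) (x : U1), f (r1 s x) = r2 s (f x).

(* Main.v *)
(* The characteristic polynomials of the trailing principal submatrices of [K]
   satisfy a three-term recurrence, whose Casoratian gives K M = L^2 - (n!)^2.
   At the nodes x_j = n - 2 j, the j-th generating function
   (1 - z)^j (1 + z)^(n - j) solves the recurrence, so that K(x_j) = 0 and
   L(x_j) = (-1)^j n!; thus L changes sign between consecutive roots of K, and
   M between consecutive roots of L, where K M = - (n!)^2.  Differentiating the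
   identity at x_j and expressing L'(x_j) by Lagrange interpolation shows that
   M(x_j) has the sign (-1)^j for 2 j < n, hence (v).

   On the cube, the characters E_u diagonalise the full adjacency operator, and
   E_u - E_v with u, v of equal weight vanishes at both deleted vertices, so it
   remains an eigenvector after the deletion.  The Fourier transform identifies
   their span with the functions of zero sum on k-subsets.  Functions of the
   weight are orthogonal to these spaces, and on them the eigenvector equation
   is the same three-term recurrence. *)

Require Import Defs.
From HB Require Import structures.
From mathcomp Require Import all_boot all_order all_algebra all_fingroup.
From mathcomp Require Import polyrcf zify ring lra.
From mathcomp Require Import reals.
From mathcomp Require Import complex.

Set Implicit Arguments.
Unset Strict Implicit.
Unset Printing Implicit Defensive.

Import Order.TTheory GRing.Theory Num.Theory.
Local Open Scope ring_scope.

(** * The three-term recurrence *)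

(** The offset [s] lets one family describe all trailing principal submatrices: deleting the first
    row and column raises [s] by one. *)
Definition tridiag (A : pzRingType) (d : A) (b c : nat -> A) (s m : nat) :
    'M[A]_m :=
  \matrix_(i, j) if i == j then d else if j == i.+1 :> nat then b (s + i)%N
                 else if i == j.+1 :> nat then c (s + j)%N else 0.

Lemma det_tridiag (A : comNzRingType) (d : A) (b c : nat -> A) (s m : nat) :
  \det (tridiag d b c s m.+2) =
  d * \det (tridiag d b c s.+1 m.+1)
    - b s * c s * \det (tridiag d b c s.+2 m).
Proof.
rewrite (expand_det_row _ ord0) !big_ord_recl big1 => [|i _]; last first.
  by rewrite mxE /= mul0r.
rewrite addr0 !mxE /= addn0; congr (_ + _).
  rewrite /cofactor /= expr0 mul1r; congr (_ * \det _).
  apply/matrixP=> i j; rewrite !mxE (inj_eq lift_inj) /=.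
  by rewrite /bump !leq0n !add1n !eqSS !addnS.
rewrite /cofactor /= expr1 (expand_det_col _ ord0) big_ord_recl.
rewrite big1 => [|i _]; last by rewrite !mxE /= mul0r.
rewrite addr0 /cofactor /= expr0 mul1r !mxE /= addn0 mulN1r mulrN mulrA.
congr (- (_ * \det _)); apply/matrixP=> i j; rewrite !mxE -!val_eqE /=.
by rewrite /bump !leq0n !add1n !eqSS !addnS.
Qed.

(* The recurrence of the characteristic polynomials of the trailing principal
   submatrices of [Kmx R n]: [contin 1 'X n k] comes from the last [k] rows and
   columns, and [contin 0 1 n k] from these rows and columns with the very last
   one removed. *)
Fixpoint contin (R : nzRingType) (p0 p1 : {poly R}) (n k : nat) : {poly R} :=
  if k isn't k'.+1 then p0 else
  if k' isn't k''.+1 then p1 else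
  'X * contin p0 p1 n k' - (k' * (n - k''))%:R *: contin p0 p1 n k''.

Lemma continSS (R : nzRingType) (p0 p1 : {poly R}) (n k : nat) :
  contin p0 p1 n k.+2 =
  'X * contin p0 p1 n k.+1 - (k.+1 * (n - k))%:R *: contin p0 p1 n k.
Proof. by []. Qed.

Lemma nat_ind2 (P : nat -> Prop) :
  P 0%N -> P 1%N -> (forall k, P k -> P k.+1 -> P k.+2) -> forall k, P k.
Proof.
move=> P0 P1 PSS k; suff: P k /\ P k.+1 by case.
by elim: k => [//|k [Pk Pk1]]; split=> //; apply: PSS.
Qed.

Section Continuants.
Variable R : realType.
Implicit Types (n k : nat) (x : R).

Let T n := tridiag ('X : {poly R}) (fun i => - (n - i)%:R%:P)
                   (fun j => - (j.+1)%:R%:P).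

(** [k] counts the trailing rows and columns left out, so the cases k = 0 and k = 1 serve K, L and M
    alike; the last hypothesis supplies the initial values at sizes 0 and 1. *)
Lemma det_tridiag_contin n k (m s : nat) (p0 p1 : {poly R}) :
  (s + m + k = n.+1)%N -> p1 = contin p0 p1 n 1 ->
  (forall j i, (i + j = n.+1 - k)%N -> (j <= 1)%N ->
     \det (T n i j) = contin p0 p1 n (j + k)) ->
  \det (T n s m) = contin p0 p1 n (m + k).
Proof.
move=> + _ base; elim/nat_ind2: m s => [|//|m IH0 IH1] s es.
- by apply: base => //; lia.
- by apply: base => //; lia.
rewrite det_tridiag IH1 ?IH0; [|lia..].
rewrite !addSn continSS -mul_polyC; congr (_ - _ * _).
rewrite mulrNN (_ : (n - s)%N = (m + k).+1); last by lia.
rewrite (_ : s.+1 = (n - (m + k))%N); last by lia.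
by rewrite natrM polyCM.
Qed.

Lemma char_poly_mx_tridiag n s m (A : 'M[R]_m) :
  (forall i j, A i j = if j == i.+1 :> nat then (n - (s + i))%:R else
                       if i == j.+1 :> nat then (s + j).+1%:R else 0) ->
  char_poly_mx A = T n s m.
Proof.
move=> AE; apply/matrixP=> i j; rewrite !mxE AE -val_eqE /=.
case: (ltngtP i j) => ij; rewrite ?mulr1n ?mulr0n ?sub0r.
- have -> : (nat_of_ord i == j.+1) = false by lia.
  by case: eqP => _ //; rewrite oppr0.
- have -> : (nat_of_ord j == i.+1) = false by lia.
  by case: eqP => _ //; rewrite oppr0.
- rewrite ij; have -> : (nat_of_ord j == j.+1) = false by lia.
  by rewrite subr0.
Qed.

Lemma det_tridiag_contin1 n (m s : nat) : (s + m = n.+1)%N ->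
  \det (T n s m) = contin 1 'X n m.
Proof.
move=> sm; have -> := @det_tridiag_contin n 0 m s 1 'X; rewrite ?addn0 //.
case=> [|[|//]] i _ _; rewrite addn0 /=; first by rewrite det_mx00.
by rewrite det_mx11 mxE eqxx.
Qed.

Lemma Kpoly_contin n : Kpoly R n = contin 1 'X n n.+1.
Proof.
rewrite -(@det_tridiag_contin1 n n.+1 0) //; congr (\det _).
apply: char_poly_mx_tridiag => i j; rewrite mxE !add0n.
by case: eqP => // _; case: eqP => // ->.
Qed.

Lemma Lpoly_contin n : Lpoly R n = contin 1 'X n n.
Proof.
rewrite -(@det_tridiag_contin1 n n 1) //; congr (\det _).
apply: char_poly_mx_tridiag => i j; rewrite !mxE /= /bump !leq0n !add1n !eqSS.
by case: eqP => // _; case: eqP => // ->.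
Qed.

(** With the last row and column gone, the empty determinant sits at index 1; index 2 must give
    ['X], which forces the initial value 0 at index 0. *)
Lemma Mpoly_contin n : (0 < n)%N -> Mpoly R n = contin 0 1 n n.
Proof.
move=> n_gt0; rewrite /Mpoly /char_poly (@char_poly_mx_tridiag n 1).
  rewrite (@det_tridiag_contin n 1 n.-1 1 0 1) ?addn1 ?prednK //; first by lia.
  case=> [|[|//]] i _ _; rewrite addn1 /=; first by rewrite det_mx00.
  by rewrite det_mx11 mxE eqxx mulr1 scaler0 subr0.
move=> i j; rewrite !mxE /= /bump !leq0n !add1n !eqSS.
by case: eqP => // _; case: eqP => // ->.
Qed.

(** Each step of the recurrence multiplies the Casoratian by the coefficient (k + 1)(n - k),
    starting from 1. *)
Lemma contin_casoratian n k :
  contin 1 'X n k * contin 0 1 n k.+1 - contin 0 1 n k * contin 1 'X n k.+1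
  = (k`! * n ^_ k)%:R%:P :> {poly R}.
Proof.
elim: k => [|k IH]; first by rewrite /= mulr1 mul0r subr0 ffactn0.
rewrite !continSS factS ffactnSr.
have -> : (k.+1 * k`! * (n ^_ k * (n - k)) =
   (k`! * n ^_ k) * (k.+1 * (n - k)))%N by lia.
rewrite [in RHS]natrM polyCM -IH -!mul_polyC; ring.
Qed.

(* The generating function of the Krawtchouk values at [j]. *)
Definition kraw n j : {poly R} := (1 - 'X) ^+ j * (1 + 'X) ^+ (n - j).

(** The logarithmic derivative -j/(1 - X) + (n - j)/(1 + X) with its denominators cleared. *)
Lemma deriv_kraw n j : (j <= n)%N ->
  (1 - 'X ^+ 2) * (kraw n j)^`() =
  ((n%:R - (2 * j)%:R)%:P - n%:R *: 'X) * kraw n j.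
Proof.
move=> jn; have expr_deriv (p : {poly R}) m :
    p * (p ^+ m)^`() = p^`() * m%:R * p ^+ m.
  case: m => [|m]; first by rewrite expr0 (derivC 1) !mulr0 mul0r.
  by rewrite deriv_exp /= exprS -mulr_natr; ring.
have := expr_deriv (1 - 'X) j; have := expr_deriv (1 + 'X) (n - j)%N.
rewrite derivB derivD derivX (derivC 1) sub0r add0r.
rewrite /kraw derivM natrB //.
set A := (1 - 'X) ^+ j; set B := (1 + 'X) ^+ (n - j) => dB dA.
transitivity ((1 + 'X) * ((1 - 'X) * A^`()) * B +
              (1 - 'X) * A * ((1 + 'X) * B^`())); first by ring.
rewrite dA dB polyCB !polyC_natr -mul_polyC polyC_natr natrM; ring.
Qed.

(** Comparing coefficients in the differential equation [deriv_kraw] yields, after scaling by k!,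
    the recurrence of [contin 1 'X]. The bound on k keeps the subtraction n - k exact. *)
Lemma contin_kraw n j k : (j <= n)%N -> (k <= n.+1)%N ->
  (contin 1 'X n k).[n%:R - (2 * j)%:R] = k`!%:R * (kraw n j)`_k.
Proof.
move=> jn; set x := _ - _ : R; set g := kraw n j.
have g0 : g`_0 = 1.
  by rewrite -horner_coef0 !hornerE ?subr0 ?addr0 !expr1n ?mulr1.
(* The subtracted term comes from X^2 times the derivative; for i = 0 and i = 1 the predecessor is 0
   and the term vanishes. *)
have deriv_coef i : g`_i.+1 *+ i.+1 - (g`_i.-1 *+ i.-1) =
    x * g`_i - (if i is i'.+1 then n%:R * g`_i' else 0).
  have := congr1 (fun p : {poly R} => p`_i) (deriv_kraw jn).
  rewrite !mulrBl mul1r !coefB coefCM -scalerAl coefZ coefXM coefXnM.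
  rewrite !coef_deriv.
  case: i => [|[|i]] /=; rewrite ?subn2 ?mulr0 /= -/g ?mulr0n ?subr0 => ->.
  - by rewrite mulrBl.
  - by rewrite mulrBl.
  - by rewrite mulrBl.
elim/nat_ind2: k => [||k IH0 IH1] kn.
- by rewrite hornerC g0 mulr1.
- have := deriv_coef 0%N; rewrite /= mulr1n mulr0n !subr0 g0 mulr1 => ->.
  by rewrite hornerX mul1r.
rewrite continSS hornerD hornerN hornerM hornerX hornerZ IH0 ?IH1; [|lia..].
have := deriv_coef k.+1; rewrite /= -(mulr_natl _ k.+2) -(mulr_natl _ k) => e.
have {}e : k.+2%:R * g`_k.+2 = x * g`_k.+1 - n%:R * g`_k + k%:R * g`_k.
  by rewrite -e; ring.
rewrite !factS !natrM natrB; last by lia.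
transitivity (k.+1%:R * k`!%:R * (k.+2%:R * g`_k.+2)); last by ring.
rewrite e; ring.
Qed.

(** Up to the sign (-1)^j this is the monic polynomial (X - 1)^j (X + 1)^(n - j) of degree n. *)
Lemma kraw_lead n j : (j <= n)%N -> (kraw n j)`_n = (-1) ^+ j.
Proof.
move=> jn.
have -> : kraw n j =
    (-1) ^+ j *: (('X - 1%:P) ^+ j * ('X - (-1)%:P) ^+ (n - j)).
  rewrite /kraw -(opprB 'X) [in LHS]exprNn -mul_polyC -mulrA.
  by rewrite rmorphXn /= !polyCN polyC1 opprK (addrC _ 1).
set p := _ * _ : {poly R}.
have pm : p \is monic by rewrite monicMl ?monic_exp ?monicXsubC.
have sp : size p = n.+1.
  rewrite size_Mmonic ?monic_neq0 ?monic_exp ?monicXsubC //.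
  by rewrite !size_exp_XsubC addSn /= addnS subnKC.
by move/monicP: pm; rewrite coefZ lead_coefE sp /= => ->; rewrite mulr1.
Qed.

Lemma size_kraw n j : (j <= n)%N -> (size (kraw n j) <= n.+1)%N.
Proof.
move=> jn; have sz (a : R) m : (size ((1 + a%:P * 'X) ^+ m)%R <= m.+1)%N.
  rewrite (leq_trans (size_poly_exp_leq _ _)) // ltnS -[leqRHS]mul1n leq_mul2r.
  apply/orP; right; rewrite -subn1 leq_subLR.
  rewrite (leq_trans (size_polyD _ _)) // size_poly1 geq_max /= mul_polyC.
  by rewrite (leq_trans (size_scale_leq _ _)) // size_polyX.
rewrite /kraw (leq_trans (size_polyMleq _ _)) //.
have := sz (-1) j; have := sz 1 (n - j)%N.
rewrite polyCN polyC1 mulN1r mul1r.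
set a := size _; set b := size _; lia.
Qed.

End Continuants.

(** * Values at the roots of K *)

Section Interpolation.
Variables (F : fieldType) (m : nat) (a : 'I_m -> F).
Hypothesis a_inj : injective a.

Let W i : {poly F} := \prod_(l | l != i) ('X - (a l)%:P).
Let D i : F := \prod_(l | l != i) (a i - a l).

Lemma horner_prod_XsubC (P : pred 'I_m) x :
  (\prod_(l | P l) ('X - (a l)%:P)).[x] = \prod_(l | P l) (x - a l).
Proof. by rewrite horner_prod; apply: eq_bigr => l _; rewrite hornerXsubC. Qed.

Lemma deriv_prod_XsubC j :
  (\prod_l ('X - (a l)%:P))^`().[a j] = D j.
Proof.
rewrite (bigD1 j) //= derivM derivXsubC mul1r hornerD hornerM hornerXsubC.
by rewrite subrr mul0r addr0 horner_prod_XsubC.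
Qed.

Lemma prodB_neq0 i : D i != 0.
Proof.
by apply/prodf_neq0 => l li; rewrite subr_eq0 eq_sym (inj_eq a_inj).
Qed.

Lemma poly_eq_at (p q : {poly F}) :
  (size p <= m)%N -> (size q <= m)%N -> (forall i, p.[a i] = q.[a i]) -> p = q.
Proof.
move=> sp sq pq; apply/eqP; rewrite -subr_eq0; apply/eqP.
apply: (@roots_geq_poly_eq0 _ _ [seq a i | i <- enum 'I_m]).
- by apply/allP=> _ /mapP[i _ ->]; rewrite rootE hornerD hornerN pq subrr.
- by rewrite map_inj_uniq ?enum_uniq.
- rewrite size_map size_enum_ord (leq_trans (size_polyD _ _)) //.
  by rewrite size_polyN geq_max sp sq.
Qed.

(* Lagrange interpolation of [p - p.[a j]] involves no basis polynomial at [j],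
   so only the value of each basis polynomial divided by ['X - a j] matters. *)
Lemma deriv_interp (p : {poly F}) j : (size p <= m)%N ->
  p^`().[a j] =
  \sum_(i | i != j) (p.[a i] - p.[a j]) / D i * (D j / (a j - a i)).
Proof.
move=> sp; pose c i := (p.[a i] - p.[a j]) / D i.
have m_gt0 : (0 < m)%N := leq_ltn_trans (leq0n _) (ltn_ord j).
have {1}-> : p = (p.[a j])%:P + \sum_(i | i != j) c i *: W i.
  apply: poly_eq_at => // [|l].
    rewrite (leq_trans (size_polyD _ _)) // geq_max.
    rewrite (leq_trans (size_polyC_leq1 _)) //=.
    apply: (leq_trans (size_sum _ _ _)); apply/bigmax_leqP => i _.
    rewrite (leq_trans (size_scale_leq _ _)) // /W.
    rewrite (eq_bigl (mem (predC1 i))) // -big_enum /=.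
    by rewrite size_prod_XsubC -cardE cardC1 card_ord prednK.
  rewrite hornerD hornerC horner_sum.
  have [->|lj] := eqVneq l j.
    rewrite big1 ?addr0 // => i ij.
    rewrite hornerZ horner_prod_XsubC (bigD1 j) 1?eq_sym //= subrr mul0r.
    by rewrite mulr0.
  rewrite (bigD1 l) //= big1 ?addr0 => [|i /andP[_ il]]; last first.
    rewrite hornerZ horner_prod_XsubC (bigD1 l) 1?eq_sym //= subrr mul0r.
    by rewrite mulr0.
  by rewrite hornerZ horner_prod_XsubC divfK ?prodB_neq0 // addrC subrK.
rewrite derivD derivC add0r raddf_sum /= horner_sum.
apply: eq_bigr => i ij; rewrite derivZ hornerZ; congr (_ * _).
rewrite /W (bigD1 j) 1?eq_sym //= derivM derivXsubC mul1r hornerD hornerM.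
rewrite hornerXsubC subrr mul0r addr0 horner_prod_XsubC /D.
rewrite [in RHS](bigD1 i) //=.
rewrite [RHS]mulrAC divff ?mul1r ?subr_eq0 1?eq_sym ?(inj_eq a_inj) //.
by apply: eq_bigl => l; rewrite andbC.
Qed.
End Interpolation.

(** Separates the indices below j from those above, where the differences of nodes have opposite
    signs. *)
Lemma big_ord_neq (T : Type) (idx : T) (op : Monoid.com_law idx) n
    (j : 'I_n.+1) (F : nat -> T) :
  \big[op/idx]_(l < n.+1 | l != j) F l =
  op (\big[op/idx]_(l < j) F l) (\big[op/idx]_(t < n - j) F (j.+1 + t)%N).
Proof.
transitivity (\big[op/idx]_(0 <= l < n.+1 | l != j) F l).
  by rewrite big_mkord; apply: eq_bigl.
rewrite (@big_cat_nat _ _ _ j) //=; last exact: ltnW.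
congr (op _ _).
  rewrite big_mkord; apply: eq_bigl => l.
  by rewrite neq_ltn ltn_ord.
rewrite big_ltn_cond // eqxx /= -{1}[j.+1]add0n big_addn big_mkord subSS.
apply: eq_big => [l|l _]; last by rewrite addnC.
by rewrite neq_ltn addnC leq_addr orbT.
Qed.

(** Passing from 0 to d multiplies the left side by (a + 1)...(a + d) and the right side by (m +
    1)...(m + d). *)
Lemma fact_exchange_leq a d m : (a <= m)%N ->
  ((a + d)`! * m`! <= a`! * (m + d)`!)%N.
Proof.
move=> am; elim: d => [|d IH]; first by rewrite !addn0.
rewrite !addnS !factS -mulnA [leqRHS]mulnCA leq_mul //.
by rewrite ltnS leq_add2r.
Qed.

Lemma fact_exchange_ltn a d m : (a < m)%N -> (0 < d)%N ->
  ((a + d)`! * m`! < a`! * (m + d)`!)%N.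
Proof.
case: d => // d am _; rewrite !addnS !factS -mulnA [ltnRHS]mulnCA.
apply: leq_ltn_trans (leq_mul (leqnn _) (fact_exchange_leq d (ltnW am))) _.
by rewrite ltn_pmul2r ?muln_gt0 ?fact_gt0 // ltnS ltn_add2r.
Qed.

(** * The nodes n - 2 j and the values of K, L and M there *)

Section Nodes.
Variables (R : realType) (n : nat).

Local Notation lam j := (n%:R - (2 * j)%:R : R).
Local Notation P := (@contin R 1 'X n).
Local Notation Q := (@contin R 0 1 n).

Lemma node_inj : injective (fun j : 'I_n.+1 => lam j).
Proof.
move=> i j /addrI /oppr_inj /eqP; rewrite eqr_nat eqn_pmul2l // => /eqP.
exact: val_inj.
Qed.

Lemma nodeB i j : lam j - lam i = (i%:R - j%:R) * 2.
Proof. rewrite !natrM; ring. Qed.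

(** The factors are 2 (l - j): those with l < j give (-1)^j 2^j j!, those with l > j give 2^(n - j)
    (n - j)!. *)
Lemma node_prod (j : 'I_n.+1) :
  \prod_(l < n.+1 | l != j) (lam j - lam l) =
  (-1) ^+ j * (2 ^+ n * (j`! * (n - j)`!)%:R).
Proof.
have below i : \prod_(l < i) (lam i - lam l) = (-1) ^+ i * (2 ^+ i * i`!%:R).
  elim: i => [|i IH]; first by rewrite big_ord0 fact0 !expr0 !mul1r.
  rewrite big_ord_recl (eq_bigr (fun l : 'I_i => lam i - lam l)).
    rewrite IH nodeB /= factS natrM !exprS; ring.
  by move=> l _; rewrite !nodeB lift0 -!natr1; ring.
have above d : \prod_(t < d) (lam j - lam (j.+1 + t)) = 2 ^+ d * d`!%:R.
  elim: d => [|d IH]; first by rewrite big_ord0 fact0 expr0 mul1r.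
  rewrite big_ord_recr /= IH nodeB factS natrM exprS addSnnS natrD; ring.
rewrite (big_ord_neq _ j (fun l => lam j - lam l)) below above natrM.
have -> : 2 ^+ n = 2 ^+ j * 2 ^+ (n - j) :> R.
  by rewrite -exprD subnKC // -ltnS.
rewrite /=; ring.
Qed.

Lemma contin_last_node j : (j <= n)%N -> (P n).[lam j] = (-1) ^+ j * n`!%:R.
Proof. by move=> jn; rewrite contin_kraw // kraw_lead // mulrC. Qed.

(** The value is a multiple of the coefficient of index n + 1 of [kraw n j], whose degree is at most
    n. *)
Lemma contin_root_node j : (j <= n)%N -> root (P n.+1) (lam j).
Proof.
move=> jn; rewrite rootE contin_kraw // nth_default ?mulr0 //.
exact: size_kraw.
Qed.

Lemma size_contin (p0 p1 : {poly R}) s k :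
  (size p0 <= s)%N -> (size p1 <= s.+1)%N ->
  (size (contin p0 p1 n k) <= s + k)%N.
Proof.
move=> s0 s1; elim/nat_ind2: k => [||k IH0 IH1]; rewrite ?addn0 ?addn1 //.
rewrite continSS (leq_trans (size_polyD _ _)) // geq_max size_polyN.
apply/andP; split.
  rewrite mulrC (leq_trans (size_polyMleq _ _)) // size_polyX addn2 /= !addnS.
  by rewrite ltnS -addnS.
rewrite (leq_trans (size_scale_leq _ _)) // (leq_trans IH0) //; lia.
Qed.

Lemma size_continP k : (size (P k) <= k.+1)%N.
Proof. by rewrite -add1n size_contin ?size_poly1 ?size_polyX. Qed.

Lemma size_continQ k : (size (Q k) <= k)%N.
Proof. by rewrite -[leqRHS]add0n size_contin ?size_poly0 ?size_poly1. Qed.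

(** At a node K vanishes, so the Casoratian reads [P n] times [Q n.+1] = n!^2, while [P n] is n! up
    to sign. Hence both polynomials agree at n + 1 nodes, and their degree is at most n. *)
Lemma contin_first_last : Q n.+1 = P n.
Proof.
apply: (poly_eq_at node_inj); rewrite ?size_continQ ?size_continP // => i /=.
have := congr1 (horner^~ (lam i)) (contin_casoratian R n n).
rewrite hornerD hornerN !hornerM hornerC ffactnn.
rewrite (rootP (contin_root_node (ltn_ord i))) mulr0 subr0.
rewrite contin_last_node -1?ltnS // => e.
have nz : (-1) ^+ i * n`!%:R != 0 :> R.
  by rewrite mulf_neq0 ?signr_eq0 // pnatr_eq0 -lt0n fact_gt0.
apply: (mulfI nz); rewrite e mulrACA -exprMn.
by rewrite mulrNN mulr1 expr1n mul1r natrM.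
Qed.

(** This is the Casoratian at index n, both factors of its first product being L by
    [contin_first_last]. *)
Lemma Lpoly_sqr : (0 < n)%N ->
  Lpoly R n ^+ 2 = Kpoly R n * Mpoly R n + (n`! ^ 2)%:R%:P.
Proof.
move=> n_gt0; rewrite Lpoly_contin Kpoly_contin Mpoly_contin //.
have := contin_casoratian R n n; rewrite contin_first_last ffactnn -mulnn => <-.
rewrite expr2; ring.
Qed.

Lemma Kpoly_prod : Kpoly R n = \prod_(j < n.+1) ('X - (lam j)%:P).
Proof.
have Km : Kpoly R n \is monic := char_poly_monic _.
have roots : all (root (Kpoly R n)) [seq lam j | j : 'I_n.+1 <- enum 'I_n.+1].
  apply/allP => _ /mapP[j _ ->]; rewrite Kpoly_contin.
  by apply: contin_root_node; rewrite -ltnS.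
rewrite (all_roots_prod_XsubC _ roots) ?(monicP Km) ?scale1r.
- by rewrite big_map big_enum.
- by rewrite size_char_poly size_map size_enum_ord.
- by rewrite uniq_rootsE (map_inj_uniq node_inj) enum_uniq.
Qed.

Lemma Lpoly_node j : (j <= n)%N -> (Lpoly R n).[lam j] = (-1) ^+ j * n`!%:R.
Proof. by move=> jn; rewrite Lpoly_contin contin_last_node. Qed.

(** Differentiating [Lpoly_sqr] at a root of K leaves 2 L L' = K' M. There K' is the product of node
    differences, and L' comes from interpolating the values (-1)^i n!. *)
Lemma Mpoly_node (j : 'I_n.+1) : (0 < n)%N ->
  (Mpoly R n).[lam j] = (-1) ^+ j * (n`! ^ 2)%:R / 2 ^+ n *
  \sum_(i < n.+1 | i != j)
     (1 - (-1) ^+ (i + j)) / (i`! * (n - i)`!)%:R / (i%:R - j%:R).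
Proof.
move=> n_gt0.
have := congr1 (fun p : {poly R} => p^`().[lam j]) (Lpoly_sqr n_gt0).
rewrite derivD derivC addr0 derivM expr2 derivM !hornerD !hornerM.
rewrite (rootP _ : (Kpoly R n).[lam j] = 0); last first.
  by rewrite Kpoly_contin; apply: contin_root_node; rewrite -ltnS.
rewrite mul0r addr0 Kpoly_prod.
have -> := deriv_prod_XsubC (fun i : 'I_n.+1 => lam i) j.
rewrite (deriv_interp node_inj); last by rewrite size_char_poly.
rewrite Lpoly_node; last by rewrite -ltnS.
have Dj := prodB_neq0 node_inj j.
move=> e; apply: (mulfI Dj); rewrite -e.
rewrite mulr_suml mulr_sumr -big_split !mulr_sumr /=.
apply: eq_bigr => i ij; rewrite Lpoly_node; last by rewrite -ltnS.
rewrite (node_prod i) nodeB exprD natrX.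
have ij0 : i%:R - j%:R != 0 :> R.
  by rewrite subr_eq0 eqr_nat; apply: contra ij => /eqP/val_inj->.
have s2 : (-1) ^+ i != 0 :> R by rewrite signr_eq0.
have s1 := sqrr_sign R i.
set r := (-1) ^+ i in s1 s2 *.
have -> : 1 - r * (-1) ^+ j = (r - (-1) ^+ j) / r.
  by apply: (mulIf s2); rewrite divfK // mulrBl mul1r mulrAC -expr2 s1 mul1r.
by field; rewrite ij0 s2 expf_neq0 ?pnatr_eq0 -?lt0n ?fact_gt0.
Qed.

(** The terms at j - 1 - t and j + 1 + t have opposite signs and equally large denominators. As 2 j
    < n, the upper index is closer to n/2 and its weight 1/(i! (n - i)!) wins; unpaired terms lie
    above j and are nonnegative. *)
Lemma node_sum_gt0 (j : 'I_n.+1) : (2 * j < n)%N ->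
  0 < \sum_(i < n.+1 | i != j)
        (1 - (-1) ^+ (i + j)) / (i`! * (n - i)`!)%:R / (i%:R - j%:R) :> R.
Proof.
move=> jn; pose w i : R := ((i`! * (n - i)`!)%:R)^-1.
have w_gt0 i : 0 < w i by rewrite invr_gt0 ltr0n muln_gt0 !fact_gt0.
have w_le t : (t < j)%N -> w (j.-1 - t)%N < w (j.+1 + t)%N.
  move=> tj; rewrite ltf_pV2 ?posrE ?ltr0n ?muln_gt0 ?fact_gt0 //.
  rewrite ltr_nat.
  have := @fact_exchange_ltn (j.-1 - t) (2 * t.+1) (n - (j.+1 + t)).
  rewrite (_ : (j.-1 - t + 2 * t.+1 = j.+1 + t)%N); last by lia.
  rewrite (_ : (n - (j.+1 + t) + 2 * t.+1 = n - (j.-1 - t))%N); last by lia.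
  by apply; lia.
pose e t : R := 1 - (-1) ^+ t.+1.
have e_ge0 t : 0 <= e t.
  by rewrite /e -signr_odd; case: odd; rewrite ?expr1 ?expr0; lra.
rewrite (big_ord_neq _ j (fun i => (1 - (-1) ^+ (i + j)) /
   (i`! * (n - i)`!)%:R / (i%:R - j%:R) : R)) /=.
(* Reversal lists the lower indices from j - 1 downwards, so that term t on either side lies at
   distance t + 1 from j. *)
rewrite (reindex_inj rev_ord_inj) /=.
rewrite (eq_bigr (fun t : 'I_j => - (e t * w (j.-1 - t)%N / t.+1%:R))).
  rewrite [X in _ + X](eq_bigr
      (fun t : 'I_(n - j) => e t * w (j.+1 + t)%N / t.+1%:R)).
    (* The first j upper terms have partners below; at least one term is left over because 2 j <
       n. *)
    rewrite (_ : (n - j = j + (n - 2 * j).-1.+1)%N); last by lia.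
    rewrite big_split_ord addrA -big_split /= big_ord_recl /=.
    have sum_ge0 : 0 <= \sum_(t < (n - 2 * j).-1)
        e (j + lift ord0 t)%N * w (j.+1 + (j + lift ord0 t))%N
          / (j + lift ord0 t).+1%:R.
      by apply: sumr_ge0 => t _; rewrite !mulr_ge0 ?invr_ge0 ?ler0n // ltW.
    have diff_ge0 (t : 'I_j) : 0 <= - (e t * w (j.-1 - t)%N / t.+1%:R) +
        e t * w (j.+1 + t)%N / t.+1%:R.
      rewrite addrC -mulrBl -mulrBr !mulr_ge0 ?invr_ge0 ?ler0n //.
      by rewrite subr_ge0 ltW ?w_le.
    have e0 : 0 < e 0%N by rewrite /e expr1 opprK addr_gt0.
    (* Strictness comes from the first unpaired term when j = 0, and otherwise from the pair at
       distance 1; in both cases [e 0] = 2. *)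
    case: (posnP j) => [j0|j_gt0].
      rewrite ltr_wpDl ?sumr_ge0 // ltr_pwDl // j0 !mulr_gt0 ?invr_gt0 //.
      by rewrite ltr0n muln_gt0 !fact_gt0.
    apply: ltr_pwDl; last first.
      by rewrite addr_ge0 // !mulr_ge0 ?invr_ge0 ?ler0n // ltW.
    rewrite (bigD1 (Ordinal j_gt0)) //= ltr_pwDl ?sumr_ge0 //.
    rewrite addrC -mulrBl -mulrBr !mulr_gt0 ?invr_gt0 ?ltr0n //.
    by rewrite subr_gt0 w_le.
  move=> t _; rewrite (_ : (j.+1 + t + j = j * 2 + t.+1)%N); last by lia.
  rewrite exprD exprM sqrr_sign mul1r.
  by rewrite addSnnS natrD addrAC subrr add0r.
move=> t _; rewrite (_ : (j - t.+1 + j = (j - t.+1) * 2 + t.+1)%N); last first.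
  by have := ltn_ord t; lia.
rewrite exprD exprM sqrr_sign mul1r (natrB _ (ltn_ord t)) addrAC subrr add0r.
rewrite invrN mulrN; congr (- (_ / _)).
by rewrite /e /w; congr (_ / (_`! * (n - _)`!)%:R); lia.
Qed.

Lemma Mpoly_node_sign j : (2 * j < n)%N ->
  0 < (-1) ^+ j * (Mpoly R n).[lam j].
Proof.
move=> jn; have n_gt0 : (0 < n)%N := leq_ltn_trans (leq0n _) jn.
have jn1 : (j < n.+1)%N by lia.
rewrite (@Mpoly_node (Ordinal jn1)) //= !mulrA.
rewrite -exprMn mulrNN mulr1 expr1n mul1r.
rewrite !mulr_gt0 ?invr_gt0 ?exprn_gt0 ?ltr0n ?expn_gt0 ?fact_gt0 //.
exact: (@node_sum_gt0 (Ordinal jn1)).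
Qed.
End Nodes.

(** * Interlacing *)

Lemma interlacing_roots (R : rcfType) (p : {poly R}) (a : seq R) :
  sorted <%R a ->
  (forall i, (i.+1 < size a)%N -> p.[a`_i] * p.[a`_i.+1] < 0) ->
  exists b : seq R, [/\ size b = (size a).-1, sorted <%R b, all (root p) b
    & forall i, (i < size b)%N -> a`_i < b`_i < a`_i.+1].
Proof.
move=> a_sorted sgn.
have ivt (i : 'I_(size a).-1) :
    exists x, root p x /\ a`_i < x < a`_i.+1.
  have ia : (i.+1 < size a)%N by have := ltn_ord i; lia.
  have aa : a`_i < a`_i.+1 by apply: (sortedP 0 a_sorted).
  have [x x_in px] := poly_ivtoo (ltW aa) (sgn _ ia).
  by exists x; split=> //; rewrite in_itv /= in x_in.
have [f fP] := fin_all_exists ivt.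
pose b := [seq f i | i <- enum 'I_(size a).-1].
have sb : size b = (size a).-1 by rewrite size_map size_enum_ord.
have nb (i : 'I_(size a).-1) : b`_i = f i.
  by rewrite (nth_map i) ?size_enum_ord // nth_ord_enum.
have b_in i : (i < size b)%N -> a`_i < b`_i < a`_i.+1.
  by rewrite sb => ib; rewrite (nb (Ordinal ib)); case: (fP (Ordinal ib)).
exists b; split=> //.
  apply/(sortedP 0) => i ib; have /andP[_ lt1] := b_in _ (ltnW ib).
  by have /andP[lt2 _] := b_in _ ib; apply: lt_trans lt1 lt2.
by apply/allP => _ /mapP[i _ ->]; case: (fP i).
Qed.

Lemma mem_all_roots (R : idomainType) (p : {poly R}) (b : seq R) :
  size p = (size b).+1 -> uniq b -> all (root p) b -> b =i root p.
Proof.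
move=> sp ub pb x; apply/idP/idP => [xb|px]; first exact: (allP pb).
apply/negPn/negP => xb; have p0 : p != 0 by rewrite -size_poly_eq0 sp.
have := max_poly_roots p0 (_ : all (root p) (x :: b)) (_ : uniq (x :: b)).
by rewrite /= -[root p x]/(x \in root p) px pb xb ub sp ltnn => /(_ isT isT).
Qed.

(** Exactly one root separates x from y, so every other factor has the same sign at both points. The
    last hypothesis is conditional because y may lie beyond the largest root. *)
Lemma prod_XsubC_gap (R : realDomainType) (a : seq R) (i : nat) (x y : R) :
  sorted <%R a -> (i.+1 < size a)%N ->
  a`_i < x < a`_i.+1 -> a`_i.+1 < y -> ((i.+2 < size a)%N -> y < a`_i.+2) ->
  (\prod_(r <- a) ('X - r%:P)).[x] * (\prod_(r <- a) ('X - r%:P)).[y] < 0.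
Proof.
move=> a_sorted ia /andP[ax xa] ay ya.
have a_le k l : (k <= l < size a)%N -> a`_k <= a`_l.
  case/andP => kl la; rewrite (lt_sorted_leq_nth 0 a_sorted) ?inE //.
  exact: leq_ltn_trans kl la.
rewrite !horner_prod -big_split (big_nth 0) big_mkord (bigD1 (Ordinal ia)) //=.
rewrite pmulr_llt0.
  by rewrite !hornerXsubC nmulr_rlt0 ?subr_lt0 ?subr_gt0.
apply: prodr_gt0 => k ki; rewrite !hornerXsubC.
have {ki} : (k <= i)%N || (i.+1 < k)%N.
  by move: ki; rewrite -val_eqE /= neq_ltn ltnS.
case/orP => ki.
  have /le_lt_trans lek : a`_k <= a`_i by rewrite a_le // ki ltnW.
  by rewrite mulr_gt0 // subr_gt0 lek // (lt_trans ax) // (lt_trans xa).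
have /(lt_le_trans _) lek : a`_i.+2 <= a`_k by rewrite a_le // ki ltn_ord.
have {}ya := lek _ (ya (leq_ltn_trans ki (ltn_ord k))).
by rewrite nmulr_rgt0 subr_lt0 // (lt_trans xa) // (lt_trans ay).
Qed.

(** As many distinct real roots as the degree split p over R, so the complex roots are the images of
    [b], with multiplicity their count there. *)
Lemma simple_real_symmetric_all_roots (R : realType) (p : {poly R})
    (b : seq R) :
  size p = (size b).+1 -> uniq b -> all (root p) b ->
  (forall x, root p x -> root p (- x)) -> simple_real_symmetric_roots p.
Proof.
move=> sp ub pb sym; rewrite /simple_real_symmetric_roots.
have /mem_all_roots -/(_ ub pb) b_roots := sp.
have p0 : lead_coef p != 0 by rewrite lead_coef_eq0 -size_poly_eq0 sp.
have pE := all_roots_prod_XsubC sp pb; rewrite uniq_rootsE in pE.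
have -> : map_poly (real_complex R) p =
    (real_complex R (lead_coef p))%:P *
      \prod_(y <- map (real_complex R) b) ('X - y%:P).
  rewrite [in LHS]pE // map_polyZ mul_polyC rmorph_prod big_map /=.
  by congr (_ *: _); apply: eq_bigr => y _; rewrite map_polyXsubC.
have c0 : real_complex R (lead_coef p) != 0 by rewrite fmorph_eq0.
move=> /= z; rewrite !rootM !rootC (negPf c0) /= !root_prod_XsubC.
case/mapP=> x xb ->.
split.
- rewrite mupMr ?rootC // mu_prod_XsubC count_uniq_mem.
    by rewrite map_f.
  by rewrite map_inj_uniq //; apply: fmorph_inj.
- by apply/complex_realP; exists x.
- rewrite -rmorphN map_f // b_roots; apply: sym.
  by have := b_roots x; rewrite xb => /esym.
Qed.

Lemma strictly_interlaces_opp (R : realType) (A B : pred R) :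
  strictly_interlaces B A ->
  strictly_interlaces [pred x | B (- x)] [pred x | A (- x)].
Proof.
move=> [a [b [[sa sb] aA bB sab ab]]].
have rev_sorted (s : seq R) : sorted <%R s -> sorted <%R (map -%R (rev s)).
  move=> ss; rewrite map_rev rev_sorted sorted_map.
  by apply: sub_sorted ss => x y /=; rewrite ltrN2.
have rev_mem (s : seq R) (C : pred R) : s =i C ->
    map -%R (rev s) =i [pred x | C (- x)].
  move=> sC x; rewrite map_rev mem_rev -[x in LHS]opprK (mem_map oppr_inj).
  exact: sC.
exists (map -%R (rev a)), (map -%R (rev b)).
split; [by split; apply: rev_sorted| exact: rev_mem..| |].
  by rewrite !size_map !size_rev.
rewrite size_map size_rev => i ib.
rewrite !(nth_map 0) ?size_rev ?sab ?ltnS ?(ltnW ib) //.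
rewrite !nth_rev ?sab ?ltnS ?(ltnW ib) // !ltrN2 !subSS andbC.
have e : (size b - i = (size b - i.+1).+1)%N by rewrite subnSK.
by rewrite e ab // -e leq_subr.
Qed.

(** The sign [s] is 1 for [contin 1 'X], and -1 for [contin 0 1], whose degrees are one lower. *)
Lemma contin_parity (R : comNzRingType) (p0 p1 : {poly R}) n (s x : R) k :
  p0.[- x] = s * p0.[x] -> p1.[- x] = - (s * p1.[x]) ->
  (contin p0 p1 n k).[- x] = (-1) ^+ k * s * (contin p0 p1 n k).[x].
Proof.
move=> e0 e1; elim/nat_ind2: k => [||k IH0 IH1].
- by rewrite expr0 mul1r.
- by rewrite expr1 mulN1r mulNr.
by rewrite continSS !hornerE IH0 IH1 !exprS; ring.
Qed.

(** * Location of the roots of K, L and M *)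

Section Roots.
Variables (R : realType) (n : nat).
Hypothesis n_gt0 : (0 < n)%N.

Local Notation lam j := (n%:R - (2 * j)%:R : R).

Lemma Kpoly_rootP x :
  root (Kpoly R n) x <-> exists2 k : nat, (k <= n)%N & x = lam k.
Proof.
split=> [|[k kn ->]]; last by rewrite Kpoly_contin contin_root_node.
rewrite Kpoly_prod -(big_map (fun j : 'I_n.+1 => lam j) xpredT
  (fun r => 'X - r%:P)) root_prod_XsubC.
by case/mapP=> j _ ->; exists j; rewrite // -ltnS.
Qed.

Lemma Kpoly_rootN x : root (Kpoly R n) x -> root (Kpoly R n) (- x).
Proof.
rewrite Kpoly_contin !rootE (@contin_parity _ _ _ _ 1) ?hornerE ?mul1r //.
by move/eqP->; rewrite mulr0.
Qed.

Lemma Lpoly_rootN x : root (Lpoly R n) x -> root (Lpoly R n) (- x).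
Proof.
rewrite Lpoly_contin !rootE (@contin_parity _ _ _ _ 1) ?hornerE ?mul1r //.
by move/eqP->; rewrite mulr0.
Qed.

Lemma Mpoly_rootN x : root (Mpoly R n) x -> root (Mpoly R n) (- x).
Proof.
rewrite Mpoly_contin // !rootE (@contin_parity _ _ _ _ (-1)) ?hornerE ?mulr0 //.
  by move/eqP->; rewrite mulr0.
by rewrite ?mulr1 opprK.
Qed.

(** For even n the polynomial M is odd. *)
Lemma Mpoly_root0 : ~~ odd n -> root (Mpoly R n) 0.
Proof.
move=> n_even; rewrite Mpoly_contin // rootE.
have := @contin_parity R 0 1 n (-1) 0 n.
rewrite oppr0 !hornerE ?mulr0 ?mulr1 opprK => /(_ erefl erefl).
rewrite -signr_odd (negPf n_even) expr0 mul1r mulN1r => /eqP.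
by rewrite -addr_eq0 -mulr2n mulrn_eq0.
Qed.

Definition nodes := mkseq (fun i => lam (n - i)) n.+1.

Lemma nodes_sorted : sorted <%R nodes.
Proof.
apply/(sortedP 0) => i; rewrite size_mkseq => i_n.
rewrite !nth_mkseq ?(ltnW i_n) // ltrD2l ltrN2 ltr_nat; lia.
Qed.

Lemma mem_nodes : nodes =i root (Kpoly R n).
Proof.
move=> x; apply/mapP/idP => [[i _ ->]|/Kpoly_rootP[k kn ->]].
  by apply/Kpoly_rootP; exists (n - i)%N; rewrite ?leq_subr.
exists (n - k)%N; first by rewrite mem_iota ltnS leq_subr.
by rewrite subKn.
Qed.

Lemma Kpoly_nodes : Kpoly R n = \prod_(r <- nodes) ('X - r%:P).
Proof.
have Km : Kpoly R n \is monic := char_poly_monic _.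
rewrite (@all_roots_prod_XsubC _ (Kpoly R n) nodes) ?(monicP Km) ?scale1r //.
- by rewrite size_char_poly size_mkseq.
- by apply/allP => x; rewrite mem_nodes.
- by rewrite uniq_rootsE lt_sorted_uniq ?nodes_sorted.
Qed.

(** L alternates between n! and -n! along the nodes, and one root in each of the n gaps exhausts its
    degree. *)
Lemma Lpoly_interlacing : exists b : seq R,
  [/\ size b = n, sorted <%R b, b =i root (Lpoly R n)
    & forall i, (i < size b)%N -> nodes`_i < b`_i < nodes`_i.+1].
Proof.
have [i|b [sb b_sorted broot b_in]] :=
    @interlacing_roots R (Lpoly R n) nodes nodes_sorted.
  rewrite size_mkseq => i_n; rewrite !nth_mkseq ?(ltnW i_n) //.
  rewrite !Lpoly_node ?leq_subr // -[(n - i)%N]prednK; last by lia.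
  rewrite (_ : (n - i).-1 = (n - i.+1)%N); last by lia.
  rewrite exprS mulN1r !mulNr mulrACA -exprMn mulrNN mulr1 expr1n mul1r.
  by rewrite oppr_lt0 mulr_gt0 // ltr0n fact_gt0.
rewrite size_mkseq /= in sb; exists b; split=> //.
by apply: mem_all_roots => //; rewrite ?size_char_poly ?sb ?lt_sorted_uniq.
Qed.

(** At the roots of L the product K M is the negative constant -n!^2. Exactly one root of K lies
    between two consecutive roots of L, so K changes sign there, and hence so does M. *)
Lemma Mpoly_interlacing (b : seq R) :
  size b = n -> sorted <%R b -> b =i root (Lpoly R n) ->
  (forall i, (i < size b)%N -> nodes`_i < b`_i < nodes`_i.+1) ->
  exists c : seq R,
  [/\ size c = n.-1, sorted <%R c, c =i root (Mpoly R n)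
    & forall i, (i < size c)%N -> b`_i < c`_i < b`_i.+1].
Proof.
move=> sb b_sorted b_root b_in.
have KM i : (i < size b)%N ->
    (Kpoly R n).[b`_i] * (Mpoly R n).[b`_i] = - (n`! ^ 2)%:R.
  move=> ib; have := congr1 (horner^~ b`_i) (Lpoly_sqr R n_gt0).
  have /rootP : root (Lpoly R n) b`_i by have := mem_nth 0 ib; rewrite b_root.
  rewrite horner_exp hornerD hornerM hornerC => -> /eqP.
  by rewrite expr0n eq_sym addr_eq0 => /eqP.
have [i|c [sc c_sorted croot c_in]] :=
    @interlacing_roots R (Mpoly R n) b b_sorted.
  move=> ib; have ib' := ltnW ib.
  have KK : (Kpoly R n).[b`_i] * (Kpoly R n).[b`_i.+1] < 0.
    have /andP[lt1 lt2] := b_in _ ib.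
    rewrite Kpoly_nodes (@prod_XsubC_gap _ nodes i) ?nodes_sorted ?b_in //.
    by rewrite size_mkseq ltnS -sb ltnW.
  have : 0 < ((Kpoly R n).[b`_i] * (Kpoly R n).[b`_i.+1]) *
             ((Mpoly R n).[b`_i] * (Mpoly R n).[b`_i.+1]).
    rewrite mulrACA !KM // mulrNN mulr_gt0 // ltr0n expn_gt0 fact_gt0 //.
  by rewrite (nmulr_rgt0 _ KK).
rewrite sb in sc; exists c; split=> //.
apply: mem_all_roots => //; rewrite ?size_char_poly ?sc //.
by rewrite lt_sorted_uniq.
Qed.

(** [Mpoly_node_sign] puts a root of M between consecutive positive nodes; symmetry and a count of
    degrees show that no other positive root exists. *)
Lemma Mpoly_interlacing_pos :
  strictly_interlaces [pred x | root (Mpoly R n) x & 0 < x]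
                      [pred x | root (Kpoly R n) x & 0 < x].
Proof.
(* p is n/2 rounded up, the number of positive nodes. *)
have [p p_n] : exists p, (n <= 2 * p <= n.+1)%N.
  by exists (uphalf n); rewrite uphalf_half; lia.
have p_gt0 : (0 < p)%N by lia.
pose a := mkseq (fun i => lam (p.-1 - i)) p.
have lam_gt0 j : (0 < lam j) = (2 * j < n)%N by rewrite subr_gt0 ltr_nat.
have a_sorted : sorted <%R a.
  apply/(sortedP 0) => i; rewrite size_mkseq => i_n.
  rewrite !nth_mkseq ?(ltnW i_n) // ltrD2l ltrN2 ltr_nat; lia.
have [i|b [sb b_sorted broot b_in]] :=
    @interlacing_roots R (Mpoly R n) a a_sorted.
  rewrite size_mkseq => i_n; rewrite !nth_mkseq ?(ltnW i_n) //.
  have s1 := @Mpoly_node_sign R n (p.-1 - i) (ltac:(lia)).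
  have s2 := @Mpoly_node_sign R n (p.-1 - i.+1) (ltac:(lia)).
  move: s1 s2; rewrite (_ : (p.-1 - i = (p.-1 - i.+1).+1)%N); last by lia.
  set k := (p.-1 - i.+1)%N; rewrite exprS mulN1r mulNr oppr_gt0 => s1 s2.
  have := mulr_gt0 s2 (_ : 0 < - ((-1) ^+ k * (Mpoly R n).[lam k.+1])).
  rewrite oppr_gt0 s1 mulrN mulrACA -exprMn mulrNN mulr1 expr1n mul1r oppr_gt0.
  by rewrite mulrC; apply.
rewrite size_mkseq in sb.
have b_gt0 x : x \in b -> 0 < x.
  case/(nthP 0) => i ib <-; have /andP[+ _] := b_in _ ib.
  rewrite sb in ib; apply: lt_trans; rewrite nth_mkseq ?lam_gt0; lia.
exists a, b; split=> //; rewrite ?size_mkseq ?sb ?prednK //.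
- move=> x; rewrite !inE; apply/mapP/andP => [|].
    case=> i; rewrite mem_iota => /andP[_ ip] ->; rewrite lam_gt0.
    split; last by lia.
    by apply/Kpoly_rootP; exists (p.-1 - i)%N => //; lia.
  case=> /Kpoly_rootP[k _ ->]; rewrite lam_gt0 => kn.
  exists (p.-1 - k)%N; first by rewrite mem_iota; lia.
  by congr (_ - (2 * _)%:R); lia.
(* The roots found, their negatives, and 0 for even n number n - 1, the degree of M. *)
pose c := [seq - x | x <- b] ++ nseq (~~ odd n) 0 ++ b.
have c_root : c =i root (Mpoly R n).
  apply: mem_all_roots.
  - rewrite size_char_poly !size_cat size_map size_nseq sb.
    by case: (boolP (odd n)) => o /=; lia.
  - rewrite !cat_uniq (map_inj_uniq oppr_inj) lt_sorted_uniq //=.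
    rewrite (_ : uniq (nseq _ _)); last by case: odd.
    rewrite andbT /=; apply/andP; split.
      apply/hasPn => x; rewrite mem_cat mem_nseq => x_in.
      apply/negP => /mapP[y /b_gt0 y_gt0 xy].
      case/orP: x_in => [/andP[_ /eqP x0]|/b_gt0].
        by move: y_gt0; rewrite -oppr_lt0 -xy x0 ltxx.
      by rewrite xy oppr_gt0 ltNge (ltW y_gt0).
    apply/hasPn => x /b_gt0 x_gt0; rewrite mem_nseq negb_and orbC.
    by rewrite gt_eqF.
  - rewrite !all_cat broot andbT; apply/andP; split.
      by apply/allP => _ /mapP[y /(allP broot) my ->]; apply: Mpoly_rootN.
    by case: (boolP (odd n)) => //= n_even; rewrite Mpoly_root0.
move=> x; rewrite inE; apply/idP/andP => [xb|[]].
  by split; [exact: (allP broot)|exact: b_gt0].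
rewrite -[root _ x]/(x \in root (Mpoly R n)) -c_root !mem_cat mem_nseq.
case/or3P => [/mapP[y /b_gt0 y_gt0 ->]|/andP[_ /eqP->]|//].
  by rewrite oppr_gt0 ltNge (ltW y_gt0).
by rewrite ltxx.
Qed.

Lemma Mpoly_interlacing_neg :
  strictly_interlaces [pred x | root (Mpoly R n) x & x < 0]
                      [pred x | root (Kpoly R n) x & x < 0].
Proof.
have rootN (p : {poly R}) : (forall x, root p x -> root p (- x)) ->
    [pred x | [pred y | root p y & 0 < y] (- x)] =1 [pred x | root p x & x < 0].
  move=> pN x /=; rewrite oppr_gt0; congr (_ && _).
  by apply/idP/idP => [/pN|/pN//]; rewrite opprK.
have [a [b [ss aK bM sab ab]]] := strictly_interlaces_opp Mpoly_interlacing_pos.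
exists a, b; split=> // x.
  by rewrite aK; apply: rootN; exact: Kpoly_rootN.
by rewrite bM; apply: rootN; exact: Mpoly_rootN.
Qed.
End Roots.

(** * Fourier analysis on the cube *)

Lemma Z2P (a : 'Z_2) : a = 0 \/ a = 1.
Proof. by case: a => [[|[|//]] ?]; [left|right]; apply: val_inj. Qed.

Lemma Z2_addxx (a : 'Z_2) : a + a = 0.
Proof. by case: (Z2P a) => ->; apply: val_inj. Qed.

Section Cube.
Variables (R : realType) (n : nat).
Implicit Types (u v w : cube n) (f g : Vcube R n) (i : 'I_n).

Definition flip v i : cube n := v + delta_mx 0 i.

Lemma flipE v i j : flip v i 0 j = v 0 j + (j == i)%:R.
Proof. by rewrite !mxE eqxx. Qed.

Lemma flipK i : involutive (flip^~ i).
Proof.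
move=> v; apply/rowP => j; rewrite !flipE -addrA.
by rewrite Z2_addxx addr0.
Qed.

Lemma flip_inj v : injective (flip v).
Proof.
move=> i j /rowP/(_ i); rewrite !flipE eqxx => /addrI.
by case: eqP.
Qed.

Lemma hdist1P u w : reflect (exists i, u = flip w i) (hdist u w == 1%N).
Proof.
apply: (iffP cards1P) => [[i ui]|[i ->]]; exists i.
  apply/rowP => j; rewrite flipE; move/setP/(_ j): ui; rewrite !inE.
  case: (Z2P (u 0 j)) (Z2P (w 0 j)) => -> [] ->; case: (j == i) => //= _;
    exact: val_inj.
apply/setP=> j; rewrite !inE flipE -subr_eq0 addrC addKr.
by case: (j == i); rewrite ?eqxx.
Qed.

Lemma sum_neighbours (A : nmodType) (F : cube n -> A) w :
  \sum_(u | hdist u w == 1%N) F u = \sum_i F (flip w i).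
Proof.
rewrite -(big_imset _ (in2W (@flip_inj w))) /=; apply: eq_bigl => u.
by apply/hdist1P/imsetP => [[i ->]|[i _ ->]]; exists i.
Qed.

(** Neighbours outside S contribute nothing to such an f, so the deleted vertices disappear from the
    formula and all three operators become the same sum over flips. *)
Lemma adj_vanishing (S : {set cube n}) f w : w \in S ->
  (forall u, u \notin S -> f u = 0) ->
  adj R S f w = \sum_i f (flip w i).
Proof.
move=> wS f0; rewrite -(sum_neighbours f) lfunE /= /adj_fun sum_ffunE.
rewrite [RHS](bigID (mem S)) /= [X in _ = _ + X]big1 ?addr0; last first.
  by move=> u /andP[_ /f0].
rewrite big_mkcond [RHS]big_mkcond /=; apply: eq_bigr => u _.
rewrite andbC; case: (u \in S) => //=.
rewrite ffunE sum_ffunE /=.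
have [uw|uw] := boolP (hdist u w == 1%N).
  rewrite (bigD1 w) ?wS //= ffunE eqxx big1 ?addr0; first exact: mulr1.
  by move=> v /andP[_ vw]; rewrite ffunE eq_sym (negPf vw).
rewrite big1 ?scaler0 // => v /andP[_ uv]; rewrite ffunE.
by have [wv|//] := eqVneq w v; rewrite wv uv in uw.
Qed.

Definition sgn2 (a : 'Z_2) : R := (-1) ^+ (a : nat).

Lemma sgn2D a b : sgn2 (a + b) = sgn2 a * sgn2 b.
Proof.
by case: (Z2P a) (Z2P b) => -> [] ->; rewrite /sgn2 /= ?expr0 ?expr1 ?mulr1
  ?mul1r ?mulrNN ?mulr1.
Qed.

Lemma EE u v : E R u v = sgn2 (dotZ2 u v).
Proof. by rewrite ffunE. Qed.

Lemma dotC u v : dotZ2 u v = dotZ2 v u.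
Proof. by apply: eq_bigr => i _; rewrite mulrC. Qed.

Lemma dotDr u v w : dotZ2 u (v + w) = dotZ2 u v + dotZ2 u w.
Proof. by rewrite -big_split; apply: eq_bigr => i _; rewrite mxE mulrDr. Qed.

Lemma dot_delta u i : dotZ2 u (delta_mx 0 i) = u 0 i.
Proof.
rewrite /dotZ2 (bigD1 i) //= big1 ?addr0 => [|j ji].
  by rewrite mxE !eqxx mulr1.
by rewrite mxE (negPf ji) andbF mulr0.
Qed.

Lemma EC u v : E R u v = E R v u.
Proof. by rewrite !EE dotC. Qed.

Lemma E_flip u v i : E R u (flip v i) = E R u v * sgn2 (u 0 i).
Proof. by rewrite !EE dotDr dot_delta sgn2D. Qed.

Lemma weight_le u : (weight u <= n)%N.
Proof. by rewrite /weight -[leqRHS]card_ord max_card. Qed.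

Lemma sum_sgn2 u : \sum_i sgn2 (u 0 i) = n%:R - (2 * weight u)%:R.
Proof.
transitivity (\sum_i (1 - (u 0 i == 1)%:R *+ 2) : R).
  apply: eq_bigr => i _; rewrite /sgn2.
  by case: (Z2P (u 0 i)) => -> /=; rewrite ?expr0 ?expr1 ?mul0rn; ring.
rewrite sumrB sumr_const card_ord sumrMnl -natr_sum -mulrnA mulnC.
congr (_ - (2 * _)%:R); rewrite /weight -sum1dep_card [RHS]big_mkcond.
by apply: eq_bigr => i _; case: (_ == _).
Qed.

Lemma sum_flip_E u v :
  \sum_i E R u (flip v i) = (n%:R - (2 * weight u)%:R) * E R u v.
Proof.
by rewrite -sum_sgn2 mulr_suml; apply: eq_bigr => i _; rewrite E_flip mulrC.
Qed.

Lemma weight_flip v i :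
  weight (flip v i) = if v 0 i == 1 then (weight v).-1 else (weight v).+1.
Proof.
pose S := [set j | v 0 j == 1]; rewrite /weight -/S.
have flipS j : (flip v i 0 j == 1) = (j \in S) (+) (j == i).
  by rewrite flipE inE; case: (Z2P (v 0 j)) => ->; case: (j == i).
have -> : (v 0 i == 1) = (i \in S) by rewrite inE.
have [iS|iS] := boolP (i \in S).
  rewrite (cardsD1 i S) iS /=; apply: eq_card => j; rewrite !inE flipS.
  by have [->|_] := eqVneq j i; rewrite ?iS ?addbF ?inE.
transitivity #|i |: S|; last by rewrite cardsU1 iS.
apply: eq_card => j; rewrite !inE flipS.
by have [->|_] := eqVneq j i; rewrite ?(negPf iS) ?addbF ?inE.
Qed.

Lemma sum_flip_weight (F : nat -> R) v :
  \sum_i F (weight (flip v i)) =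
  (weight v)%:R * F (weight v).-1 + (n - weight v)%:R * F (weight v).+1.
Proof.
rewrite (bigID (fun i => v 0 i == 1)) /=; congr (_ + _).
  rewrite (eq_bigr (fun _ => F (weight v).-1)) => [|i vi].
    rewrite sumr_const mulr_natl; congr (_ *+ _).
    by apply: eq_card => i; rewrite !inE.
  by rewrite weight_flip vi.
rewrite (eq_bigr (fun _ => F (weight v).+1)) => [|i vi].
  rewrite sumr_const mulr_natl; congr (_ *+ _).
  have := cardsC [set i | v 0 i == 1]; rewrite card_ord -/(weight v) => e.
  transitivity #|~: [set i | v 0 i == 1]|; last by lia.
  by apply: eq_card => i; rewrite !inE.
by rewrite weight_flip (negPf vi).
Qed.

(** Self-adjointness of the full adjacency operator, each flip being an involution. *)
Lemma inner_flipC f g :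
  \sum_v (\sum_i f (flip v i)) * g v = \sum_v f v * \sum_i g (flip v i).
Proof.
under eq_bigr do rewrite mulr_suml; under [RHS]eq_bigr do rewrite mulr_sumr.
rewrite exchange_big [RHS]exchange_big /=; apply: eq_bigr => i _.
rewrite (reindex_inj (inv_inj (flipK i))) /=.
by apply: eq_bigr => v _; rewrite flipK.
Qed.

(* [E R u] is an eigenvector of the symmetric operator [A_{Q_n}], which maps
   [weight_vec j] to a combination of [weight_vec j.+1] and [weight_vec j.-1]:
   this is the recurrence of the Krawtchouk polynomials. *)
Lemma inner_weight_E_rec j u :
  let a k := \sum_v weight_vec R n k v * E R u v in
  j.+1%:R * a j.+1 = (n%:R - (2 * weight u)%:R) * a j -
    (if j is k.+1 then (n - k)%:R * a k else 0).
Proof.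
move=> a.
have : \sum_v (\sum_i weight_vec R n j (flip v i)) * E R u v =
  (n%:R - (2 * weight u)%:R) * a j.
  rewrite inner_flipC mulr_sumr; apply: eq_bigr => v _.
  by rewrite sum_flip_E mulrCA.
move=> <-; apply/eqP; rewrite eq_sym subr_eq; apply/eqP.
rewrite mulr_sumr; case: j => [|j].
  rewrite addr0; apply: eq_bigr => v _; rewrite mulrA; congr (_ * _).
  under eq_bigr do rewrite ffunE.
  rewrite (sum_flip_weight (fun k => (k == 0%N)%:R)) ffunE /= mulr0 addr0.
  by case: (weight v) => [|[|k]] /=; rewrite ?mulr0 ?mul0r ?mulr1.
rewrite mulr_sumr -big_split; apply: eq_bigr => v _ /=.
rewrite !mulrA -mulrDl; congr (_ * _).
under eq_bigr do rewrite ffunE.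
rewrite (sum_flip_weight (fun k => (k == j.+1)%:R)) !ffunE eqSS.
congr (_ + _).
  case: (weight v) => [|k] /=; first by rewrite mul0r mulr0.
  by rewrite eqSS; case: eqP => [->|_]; rewrite ?mulr0 ?mulr1.
by case: eqP => [->|_]; rewrite ?mulr0 ?mulr1.
Qed.

Lemma weight_eq0 v : (weight v == 0%N) = (v == zerov n).
Proof.
rewrite cards_eq0; apply/eqP/eqP => [/setP v0|->]; last first.
  by apply/setP=> i; rewrite !inE mxE.
apply/rowP => i; have := v0 i; rewrite !inE mxE.
by case: (Z2P (v 0 i)) => ->.
Qed.

Lemma E_zerov u : E R u (zerov n) = 1.
Proof.
rewrite EE /dotZ2 big1 => [|i _]; first by rewrite /sgn2 expr0.
by rewrite mxE mulr0.
Qed.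

Lemma inner_weight0_E u : \sum_v weight_vec R n 0 v * E R u v = 1.
Proof.
rewrite (bigD1 (zerov n)) //= big1 ?addr0 => [|v v0].
  by rewrite E_zerov ffunE weight_eq0 eqxx mulr1.
by rewrite ffunE weight_eq0 (negPf v0) mul0r.
Qed.

(** Both the recurrence and its initial value see u only through its weight. *)
Lemma inner_weight_E j u u' : weight u = weight u' ->
  \sum_v weight_vec R n j v * E R u v = \sum_v weight_vec R n j v * E R u' v.
Proof.
move=> uu'; elim/nat_ind2: j => [||j IH0 IH1].
- by rewrite !inner_weight0_E.
- have := inner_weight_E_rec 0 u; have := inner_weight_E_rec 0 u'.
  by rewrite /= !inner_weight0_E !mul1r uu' => -> ->.
have j0 : j.+2%:R != 0 :> R by rewrite pnatr_eq0.
apply: (mulfI j0); rewrite !(inner_weight_E_rec j.+1) /=.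
by rewrite IH0 IH1 uu'.
Qed.

(** Equivalently, functions of the weight are orthogonal to differences of characters of equal
    weight. *)
Lemma sum_weight_E (F : nat -> R) u u' : weight u = weight u' ->
  \sum_v F (weight v) * E R u v = \sum_v F (weight v) * E R u' v.
Proof.
move=> uu'.
have decomp (x : cube n) : \sum_v F (weight v) * E R x v =
    \sum_(j < n.+1) F j * \sum_v weight_vec R n j v * E R x v.
  under [RHS]eq_bigr do rewrite mulr_sumr.
  rewrite exchange_big /=; apply: eq_bigr => v _.
  have vn : (weight v < n.+1)%N by rewrite ltnS weight_le.
  rewrite (bigD1 (Ordinal vn)) //= big1 ?addr0 => [|j jv].
    by rewrite [weight_vec _ _ _ _]ffunE /= eqxx mul1r.
  rewrite [weight_vec _ _ _ _]ffunE (_ : (weight v == j) = false).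
    by rewrite mul0r mulr0.
  by apply: contra_neqF jv => /eqP vj; apply: val_inj.
by rewrite !decomp; apply: eq_bigr => j _; rewrite (inner_weight_E _ uu').
Qed.

Let N : R := #|{: cube n}|%:R.

Lemma card_cube_neq0 : N != 0.
Proof. by rewrite pnatr_eq0 -lt0n; apply/card_gt0P; exists 0. Qed.

(** If v and w differ at i, flipping the i-th coordinate of u negates every product, so the sum
    equals its own negative. *)
Lemma E_orthogonal v w : \sum_u E R u v * E R u w = (v == w)%:R * N.
Proof.
have [->|vw] := eqVneq v w.
  rewrite (eq_bigr (fun _ => 1)) ?sumr_const ?mul1r // => u _.
  rewrite EE -sgn2D Z2_addxx /sgn2 expr0 //.
rewrite mul0r; have [i vwi] : exists i, v 0 i + w 0 i = 1.
  have [j vwj] : exists j, v 0 j != w 0 j.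
    apply/existsP; apply: contra_neqT vw => /existsPn vw; apply/rowP => j.
    by apply/eqP/negbNE.
  exists j; case: (Z2P (v 0 j)) (Z2P (w 0 j)) vwj => -> [] -> // _;
    exact: val_inj.
have : \sum_u E R u v * E R u w = - \sum_u E R u v * E R u w.
  rewrite {1}(reindex_inj (inv_inj (flipK i))) /= -sumrN.
  apply: eq_bigr => u _; rewrite !(EC (flip u i)) !E_flip mulrACA -sgn2D vwi.
  by rewrite /sgn2 /= expr1 mulrN1 !(EC _ u).
by move/eqP; rewrite -addr_eq0 -mulr2n mulrn_eq0 => /eqP.
Qed.

Definition fourier f u : R := N^-1 * \sum_v f v * E R u v.

Lemma fourier_inv f : f = \sum_u fourier f u *: E R u.
Proof.
apply/ffunP => w; rewrite sum_ffunE.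
transitivity (N^-1 * \sum_u \sum_v f v * (E R u v * E R u w)).
  rewrite exchange_big (bigD1 w) //= [X in _ + X]big1 => [|v vw].
    rewrite -mulr_sumr E_orthogonal eqxx mul1r addr0 mulrCA mulVf ?mulr1 //.
    exact: card_cube_neq0.
  by rewrite -mulr_sumr E_orthogonal (negPf vw) mul0r mulr0.
rewrite mulr_sumr; apply: eq_bigr => u _; rewrite [RHS]ffunE /fourier.
rewrite -[RHS]mulrA mulr_suml; congr (_ * _).
by apply: eq_bigr => v _; rewrite mulrA.
Qed.

Lemma fourier_linear u : linear (fourier^~ u : Vcube R n -> R^o).
Proof.
move=> a f g; rewrite /fourier /GRing.scale /= mulrCA -mulrDr; congr (_ * _).
rewrite mulr_sumr -big_split; apply: eq_bigr => v _.
by rewrite !ffunE mulrDl mulrA.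
Qed.

Lemma fourier_E u v : fourier (E R v) u = (v == u)%:R.
Proof.
rewrite /fourier; under eq_bigr => w _ do rewrite (EC v) (EC u).
by rewrite E_orthogonal mulrC mulfK ?card_cube_neq0.
Qed.

Lemma fourier0 u : fourier 0 u = 0.
Proof. by rewrite /fourier big1 ?mulr0 // => v _; rewrite ffunE mul0r. Qed.

Lemma fourier_sum (I : finType) (c : I -> R) (h : I -> cube n) u :
  fourier (\sum_j c j *: E R (h j)) u = \sum_j c j * (h j == u)%:R.
Proof.
elim/big_rec2: _ => [|j x f _ IH]; first exact: fourier0.
by rewrite fourier_linear fourier_E IH.
Qed.
End Cube.

(** * The spaces spanned by differences of characters *)

Lemma span_ind (K : fieldType) (V : vectType K) (X : seq V) (P : V -> Prop) :
  P 0 -> (forall a x y, x \in X -> P y -> P (a *: x + y)) ->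
  forall v, v \in <<X>>%VS -> P v.
Proof.
move=> P0; elim: X => [|x X IH] PD v; first by rewrite span_nil memv0 => /eqP->.
rewrite span_cons => /memv_addP[_ /vlineP[a ->] [y yX ->]].
apply: (PD); first exact: mem_head.
by apply: IH yX => b z t zX; apply: PD; rewrite inE zX orbT.
Qed.

Section Eigenspaces.
Variables (R : realType) (n : nat).
Implicit Types (u v w : cube n) (f g h : Vcube R n) (i : 'I_n) (s : 'S_n).

Local Notation lam k := (n%:R - (2 * k)%:R : R).

Lemma mem_leigenspace (A : 'End(Vcube R n)) x f :
  (f \in passmx.leigenspace A x) = (A f == x *: f).
Proof.
by rewrite memv_ker add_lfunE opp_lfunE scale_lfunE id_lfunE subr_eq0.
Qed.

Lemma adj_eigenP (S : {set cube n}) f x :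
  (forall u, u \notin S -> f u = 0) ->
  (adj R S f = x *: f <->
   forall w, w \in S -> \sum_i f (flip w i) = x * f w).
Proof.
move=> f0; split=> [Af w wS|Af].
  by rewrite -(adj_vanishing wS f0) Af ffunE.
apply/ffunP => w; rewrite [RHS]ffunE; have [wS|wS] := boolP (w \in S).
  by rewrite adj_vanishing // Af.
by rewrite adj_stable // f0 // scaler0.
Qed.

Lemma fourier_sum_flip f u :
  #|{: cube n}|%:R^-1 * \sum_v (\sum_i f (flip v i)) * E R u v =
  lam (weight u) * fourier f u.
Proof.
rewrite inner_flipC mulrCA; congr (_ * _); rewrite mulr_sumr.
by apply: eq_bigr => v _; rewrite sum_flip_E mulrCA.
Qed.

Definition wvec (k : nat) : cube n := \row_i (i < k)%:R.

Lemma weight_wvec k : (k <= n)%N -> weight (wvec k) = k.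
Proof.
move=> kn; rewrite /weight -sum1dep_card.
rewrite (eq_bigl (fun i : 'I_n => (i < k)%N)); last first.
  by move=> i; rewrite mxE; case: (i < k)%N.
by rewrite (big_ord_narrow kn) sum1_card card_ord.
Qed.

(** A nonzero eigenvector has a nonzero Fourier coefficient, at which the eigenvector equation gives
    the eigenvalue; conversely, characters realise every listed value. *)
Lemma leigenvalue_hypercube x :
  passmx.leigenvalue (adj R (Q n)) x <-> exists2 k, (k <= n)%N & x = lam k.
Proof.
have f0 f u : u \notin Q n -> f u = 0 by rewrite inE.
split=> [|[k kn ->]].
  rewrite /passmx.leigenvalue -vpick0; set f := vpick _ => f_neq0.
  have : f \in passmx.leigenspace (adj R (Q n)) x by exact: memv_pick.
  rewrite mem_leigenspace => /eqP/(adj_eigenP _ (f0 f)) Af.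
  have [u fu] : exists u, fourier f u != 0.
    apply/existsP; apply: contra_neqT f_neq0 => /existsPn fu0.
    rewrite (fourier_inv f) big1 // => u _.
    by rewrite (eqP (negbNE (fu0 u))) scale0r.
  exists (weight u); first exact: weight_le.
  apply: (mulIf fu); rewrite -fourier_sum_flip /fourier mulrCA mulr_sumr.
  by congr (_ * _); apply: eq_bigr => v _; rewrite Af ?inE // mulrA.
rewrite /passmx.leigenvalue; apply: contraTneq (oner_neq0 R) => eig0.
have : E R (wvec k) \in passmx.leigenspace (adj R (Q n)) (lam k).
  rewrite mem_leigenspace; apply/eqP/adj_eigenP => [|w _]; first exact: f0.
  by rewrite sum_flip_E weight_wvec.
by rewrite eig0 memv0 => /eqP e; rewrite -(E_zerov R (wvec k)) e ffunE eqxx.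
Qed.

Lemma hhVk_ind k (P : Vcube R n -> Prop) :
  P 0 ->
  (forall a u v g, weight u = k -> weight v = k -> P g ->
     P (a *: (E R u - E R v) + g)) ->
  forall f, f \in hhVk R n k -> P f.
Proof.
move=> P0 PD; apply: span_ind => // a _ g /allpairsP[[u v] /= [uk vk ->]].
by move: uk vk; rewrite !mem_enum !inE => /eqP uk /eqP vk; apply: PD.
Qed.

Lemma mem_hhVk_sub k u v : weight u = k -> weight v = k ->
  E R u - E R v \in hhVk R n k.
Proof.
move=> uk vk; apply: memv_span; apply/allpairsP; exists (u, v).
by rewrite !mem_enum !inE uk vk.
Qed.

(** Since the coefficients sum to zero, the fixed character of [wvec k] can be subtracted from each
    term. *)
Lemma mem_hhVk_sum k (I : finType) (c : I -> R) (h : I -> cube n) :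
  (k <= n)%N -> (forall j, weight (h j) != k -> c j = 0) -> \sum_j c j = 0 ->
  \sum_j c j *: E R (h j) \in hhVk R n k.
Proof.
move=> kn c0 sum0.
have -> : \sum_j c j *: E R (h j) = \sum_j c j *: (E R (h j) - E R (wvec k)).
  under [RHS]eq_bigr do rewrite scalerBr.
  by rewrite sumrB -scaler_suml sum0 scale0r subr0.
apply: memv_suml => j _; have [jk|/c0->] := eqVneq (weight (h j)) k.
  by rewrite memvZ // mem_hhVk_sub // weight_wvec.
by rewrite scale0r mem0v.
Qed.

Lemma E_onev u : E R u (onev n) = (-1) ^+ weight u.
Proof.
rewrite EE; have -> : dotZ2 u (onev n) = (weight u)%:R.
  rewrite /dotZ2 /weight -sum1dep_card natr_sum [RHS]big_mkcond.
  by apply: eq_bigr => i _; rewrite mxE mulr1; case: (Z2P (u 0 i)) => ->.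
elim: (weight u) => [|k IH]; first by rewrite /sgn2 !expr0.
by rewrite -natr1 sgn2D IH exprSr.
Qed.

Lemma combE a f g h w : (a *: (f - g) + h) w = a * (f w - g w) + h w.
Proof. by rewrite !ffunE. Qed.

(** All characters equal 1 at [zerov], and at [onev] their value depends only on the weight, so the
    differences vanish at both. *)
Lemma hhVk_sub_hhV k : (hhVk R n k <= hhV R n)%VS.
Proof.
apply/subvP; apply: hhVk_ind => [|a u v g uk vk]; first exact: mem0v.
rewrite !memhhV !combE !E_zerov !E_onev uk vk !subrr !mulr0.
by case/andP => /eqP-> /eqP->; rewrite addr0 eqxx.
Qed.

Lemma hhVk_sum_flip k f w : f \in hhVk R n k ->
  \sum_i f (flip w i) = lam k * f w.
Proof.
move: f; apply: hhVk_ind => [|a u v g uk vk IH].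
  by rewrite big1 => [|i _]; rewrite ffunE // mulr0.
under eq_bigr do rewrite combE; rewrite combE big_split /= IH mulrDr.
congr (_ + _); rewrite -mulr_sumr sumrB !sum_flip_E uk vk.
by rewrite -mulrBr mulrCA.
Qed.

(** Converse of [mem_hhVk_sum]: the space corresponds to the zero-sum functions on the vertices of
    weight k. *)
Lemma hhVk_fourier k f : f \in hhVk R n k ->
  (forall u, weight u != k -> fourier f u = 0) /\ \sum_u fourier f u = 0.
Proof.
move: f; apply: hhVk_ind => [|a u v g uk vk [IH1 IH2]].
  by split=> [u _|]; rewrite ?big1 // => *; rewrite fourier0.
have fD w : fourier (a *: (E R u - E R v) + g) w =
    a * ((u == w)%:R - (v == w)%:R) + fourier g w.
  rewrite fourier_linear (addrC (E R u)) -scaleN1r fourier_linear !fourier_E.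
  by rewrite scaleN1r (addrC (- _)).
split=> [w wk|].
  have wne (x : cube n) : weight x = k -> (x == w) = false.
    by move=> xk; apply: contraNF wk => /eqP<-; rewrite xk.
  by rewrite fD IH1 // !wne // subrr mulr0 addr0.
under eq_bigr do rewrite fD; rewrite big_split /= IH2 addr0 -mulr_sumr sumrB.
have sum1 (x : cube n) : \sum_w (x == w)%:R = 1 :> R.
  rewrite (bigD1 x) //= eqxx big1 ?addr0 // => w /negPf.
  by rewrite eq_sym => ->.
by rewrite !sum1 subrr mulr0.
Qed.

End Eigenspaces.

(** * The action of the symmetric group *)

Section Action.
Variables (R : realType) (n : nat).
Implicit Types (u v w : cube n) (f g : Vcube R n) (i : 'I_n) (s : 'S_n).

Lemma cube_actK s : cancel (cube_act s) (cube_act s^-1).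
Proof. by move=> u; apply/rowP => i; rewrite !mxE invgK permK. Qed.

Lemma cube_actKV s : cancel (cube_act s^-1) (cube_act s).
Proof. by move=> u; rewrite -{1}[s]invgK cube_actK. Qed.

Lemma weight_cube_act s u : weight (cube_act s u) = weight u.
Proof.
rewrite /weight -[RHS](card_imset _ (@perm_inj _ s)); apply: eq_card => i.
rewrite !inE mxE; apply/idP/imsetP => [ui|[j uj ->]].
  by exists (s^-1 i)%g; rewrite ?inE // permKV.
by rewrite permK; rewrite inE in uj.
Qed.

Lemma space_actE s f v : space_act s f v = f (cube_act s^-1 v).
Proof.
rewrite /space_act sum_ffunE (bigD1 (cube_act s^-1 v)) //= big1 ?addr0.
  by rewrite !ffunE cube_actKV eqxx; apply: mulr1.
move=> u uv; rewrite !ffunE (_ : (v == _) = false) ?scaler0 //.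
by apply: contraNF uv => /eqP->; rewrite cube_actK.
Qed.

Lemma E_cube_act s u v : E R u (cube_act s^-1 v) = E R (cube_act s u) v.
Proof.
rewrite !EE; congr sgn2; rewrite /dotZ2 (reindex_inj (@perm_inj _ s^-1)).
by apply: eq_bigr => i _; rewrite !mxE invgK permKV.
Qed.

Lemma hhVk_act_stable k : act_stable (hhVk R n k).
Proof.
move=> s; apply: hhVk_ind => [|a u v g uk vk IH].
  rewrite (_ : space_act s 0 = 0) ?mem0v //.
  by apply/ffunP => v; rewrite space_actE !ffunE.
have -> : space_act s (a *: (E R u - E R v) + g) =
    a *: (E R (cube_act s u) - E R (cube_act s v)) + space_act s g.
  by apply/ffunP => w; rewrite space_actE !combE space_actE !E_cube_act.
by rewrite memvD // memvZ // mem_hhVk_sub // weight_cube_act.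
Qed.

Lemma fourier_act s f u :
  fourier (space_act s f) u = fourier f (cube_act s^-1 u).
Proof.
rewrite /fourier; congr (_ * _).
rewrite (reindex_inj (can_inj (cube_actK s))) /=; apply: eq_bigr => v _.
by rewrite space_actE cube_actK -E_cube_act invgK.
Qed.

(** * Isomorphism with the permutation representation on k-subsets *)

Section PermutationRepresentation.
Variable k : nat.
Hypothesis k_le : (k <= n)%N.
Implicit Types A B : ksubset n k.

Definition indvec A : cube n := \row_i (i \in val A)%:R.

Lemma weight_indvec A : weight (indvec A) = k.
Proof.
rewrite -(eqP (valP A)) /weight; apply: eq_card => i.
by rewrite !inE mxE; case: (i \in val A).
Qed.

Lemma indvec_inj : injective indvec.
Proof.
move=> A B /rowP AB; apply: val_inj; apply/setP => i.
by have := AB i; rewrite !mxE; case: (i \in val A); case: (i \in val B).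
Qed.

Lemma indvec_surj u : weight u = k -> exists A, u = indvec A.
Proof.
move=> /eqP uk; exists (exist _ [set i | u 0 i == 1] uk); apply/rowP => i.
by rewrite !mxE inE; case: (Z2P (u 0 i)) => ->.
Qed.

Lemma sum_indvec (V : nmodType) (F : cube n -> V) :
  \sum_A F (indvec A) = \sum_(u | weight u == k) F u.
Proof.
rewrite -(big_imset _ (in2W indvec_inj)) /=; apply: eq_bigl => u.
apply/imsetP/eqP => [[A _ ->]|/indvec_surj[A ->]]; first exact: weight_indvec.
by exists A.
Qed.

Lemma indvec_act s A : indvec (ksubset_act s A) = cube_act s (indvec A).
Proof.
apply/rowP => i; rewrite !mxE /=; congr (_%:R); congr nat_of_bool.
by rewrite -{1}(permKV s i) mem_imset //; apply: perm_inj.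
Qed.

Lemma ksubset_perm_actE s (f : {ffun ksubset n k -> R^o}) A :
  ksubset_perm_act s f (ksubset_act s A) = f A.
Proof.
rewrite /ksubset_perm_act sum_ffunE (bigD1 A) //= big1 ?addr0.
  by rewrite !ffunE eqxx; apply: mulr1.
move=> B BA; rewrite !ffunE (_ : (_ == _) = false) ?scaler0 //.
apply: contraNF BA => /eqP AB; apply/eqP/indvec_inj/(can_inj (cube_actK s)).
by rewrite -!indvec_act AB.
Qed.

Lemma ksubset_act_surj s B : exists A, B = ksubset_act s A.
Proof.
have [|A AB] := @indvec_surj (cube_act s^-1 (indvec B)).
  by rewrite weight_cube_act weight_indvec.
by exists A; apply: indvec_inj; rewrite indvec_act -AB cube_actKV.
Qed.

Lemma card_ksubset_neq0 : #|{: ksubset n k}|%:R != 0 :> R.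
Proof.
rewrite pnatr_eq0 -lt0n; apply/card_gt0P.
by have [A _] := indvec_surj (weight_wvec k_le); exists A.
Qed.

Local Notation W := (hhVk R n k).

(** Fourier coefficients cover the zero-sum functions; the trivial summand enters as the
    constants. *)
Definition to_ksubsets (x : subvs_of W * R^o) : {ffun ksubset n k -> R^o} :=
  [ffun A => fourier (vsval x.1) (indvec A) + x.2].

Lemma to_ksubsets_linear : linear to_ksubsets.
Proof.
move=> a [f b] [g c]; apply/ffunP => A; rewrite !ffunE.
have -> : vsval (a *: (f, b) + (g, c)).1 = a *: vsval f + vsval g.
  exact: linearP.
by rewrite fourier_linear [a *: (_ + _)]mulrDr addrACA.
Qed.

HB.instance Definition _ := GRing.isLinear.Build R (subvs_of W * R^o)%type
  {ffun ksubset n k -> R^o} *:%R to_ksubsets to_ksubsets_linear.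

Definition mean (f : {ffun ksubset n k -> R^o}) : R :=
  (\sum_A f A) / #|{: ksubset n k}|%:R.

(** The inverse: the mean is the constant part, and the deviation from it has zero sum, hence is the
    Fourier transform of a vector of [W]. *)
Definition of_ksubsets (f : {ffun ksubset n k -> R^o}) : subvs_of W * R^o :=
  (vsproj W (\sum_A (f A - mean f) *: E R (indvec A)), mean f).

Lemma rep_iso_ksubsets :
  rep_iso (add_triv_act (@sub_act R n W)) (@ksubset_perm_act R n k).
Proof.
exists to_ksubsets; split; last first.
  (* [vsproj] acts as the identity because [W] is stable, and both actions fix the constant part;
     what remains is equivariance of the Fourier transform. *)
  move=> s x; apply/ffunP => B; have [A ->] := ksubset_act_surj s B.
  rewrite ksubset_perm_actE !ffunE /= vsprojK; last first.
    by apply: hhVk_act_stable; apply: subvsP.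
  by rewrite fourier_act indvec_act cube_actK.
exists of_ksubsets.
  move=> [f b].
  have [supp sum0] := hhVk_fourier (subvsP f).
  have mean_b : mean (to_ksubsets (f, b)) = b.
    rewrite /mean; under eq_bigr do rewrite ffunE.
    rewrite big_split /= (sum_indvec (fourier (vsval f))) sumr_const.
    rewrite (_ : \sum_(u | _) _ = 0) ?add0r.
      by rewrite -[b *+ _]mulr_natr mulfK ?card_ksubset_neq0.
    rewrite -[RHS]sum0 big_mkcond; apply: eq_bigr => u _.
    by case: ifPn => // /supp.
  rewrite /of_ksubsets mean_b; congr (_, _).
  rewrite -[RHS]vsvalK; congr vsproj.
  under eq_bigr do rewrite ffunE /= addrK.
  rewrite (sum_indvec (fun u => fourier (vsval f) u *: E R u)).
  rewrite [RHS]fourier_inv big_mkcond; apply: eq_bigr => u _.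
  by case: ifPn => // /supp->; rewrite scale0r.
move=> f; apply/ffunP => A; rewrite ffunE /= vsprojK.
  rewrite (fourier_sum (fun A => f A - mean f)) (bigD1 A) //= eqxx mulr1.
  rewrite big1 ?addr0 ?subrK // => B BA.
  by rewrite (inj_eq indvec_inj) (negPf BA) mulr0.
apply: mem_hhVk_sum => // [B|]; first by rewrite weight_indvec eqxx.
rewrite sumrB sumr_const -[_ *+ _]mulr_natr /mean divfK ?subrr //.
exact: card_ksubset_neq0.
Qed.
End PermutationRepresentation.

End Action.

(** * Functions of the weight *)

Section WeightFunctions.
Variables (R : realType) (n : nat).
Implicit Types (u v w : cube n) (f g : Vcube R n) (s : 'S_n).

Local Notation lam k := (n%:R - (2 * k)%:R : R).
Local Notation wspan m := <<[seq weight_vec R n k | k <- iota 1 m]>>%VS.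

Lemma weight_spanP m f :
  f \in wspan m <->
  exists2 c : nat -> R, forall j, ~~ (1 <= j <= m)%N -> c j = 0
    & forall v, f v = c (weight v).
Proof.
split.
  move: f; apply: span_ind => [|a _ g /mapP[k km ->] [c c0 gc]].
    by exists (fun=> 0) => // v; rewrite ffunE.
  exists (fun j => a * (j == k)%:R + c j) => [j jm|v]; last first.
    by rewrite !ffunE gc.
  rewrite c0 // addr0 (_ : (j == k) = false) ?mulr0 //.
  by apply: contraNF jm => /eqP->; move: km; rewrite mem_iota add1n ltnS.
case=> c c0 fc; have -> : f = \sum_(k <- iota 1 m) c k *: weight_vec R n k.
  apply/ffunP => v; rewrite sum_ffunE fc.
  under eq_bigr do rewrite !ffunE.
  have [vm|vm] := boolP (weight v \in iota 1 m).
    rewrite (bigD1_seq (weight v)) ?iota_uniq //= eqxx big1 ?addr0.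
      by rewrite [RHS]mulr1.
    by move=> k; rewrite eq_sym => /negPf->; apply: mulr0.
  rewrite big_seq big1 => [|k km].
    by apply: c0; apply: contra vm => vm; rewrite mem_iota add1n ltnS.
  rewrite (_ : (weight v == k) = false); first exact: mulr0.
  by apply: contraNF vm => /eqP->.
rewrite big_seq; apply: memv_suml => k km; apply/memvZ/memv_span.
exact: map_f.
Qed.

Lemma weight_span_act m : act_trivial (wspan m).
Proof.
move=> s f /weight_spanP[c _ fc]; apply/ffunP => v.
by rewrite space_actE !fc weight_cube_act.
Qed.

(** A function of the weight lying in the sum is orthogonal to itself, so its sum of squares is
    zero. *)
Lemma weight_span_capv m (W : {vspace Vcube R n}) : (W <= wspan m)%VS ->
  (W :&: \sum_(1 <= k < n) hhVk R n k = 0)%VS.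
Proof.
move=> sW; apply/eqP; rewrite -subv0; apply/subvP => f.
rewrite memv_cap => /andP[/(subvP sW)/weight_spanP[c _ fc] f_sum].
have orth : forall g, g \in (\sum_(1 <= k < n) hhVk R n k)%VS ->
    \sum_v c (weight v) * g v = 0.
  elim/big_ind: _ => [g|U V IHU IHV g|k _].
  - by rewrite memv0 => /eqP->; rewrite big1 // => v _; rewrite ffunE mulr0.
  - case/memv_addP => [x /IHU xU [y /IHV yV ->]].
    under eq_bigr do rewrite ffunE mulrDr.
    by rewrite big_split /= xU yV addr0.
  apply: hhVk_ind => [|a u v g uk vk IH].
    by rewrite big1 // => v _; rewrite ffunE mulr0.
  under eq_bigr do rewrite combE mulrDr mulrCA mulrBr.
  rewrite big_split /= IH addr0 -mulr_sumr sumrB.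
  by rewrite (@sum_weight_E _ _ _ u v) ?uk // subrr mulr0.
have := orth f f_sum; under eq_bigr do rewrite -fc -expr2.
move/eqP; rewrite psumr_eq0 => [/allP f0|v _]; last exact: sqr_ge0.
rewrite memv0; apply/eqP/ffunP => v; rewrite ffunE.
by have := f0 v (mem_index_enum v); rewrite /= sqrf_eq0 => /eqP.
Qed.

(* [d i] is the value of an eigenvector at weight [n - i]: running through the
   weights downwards makes the eigenvector equation a recurrence, of which
   [d i = p_i(x) (n - i)!] is a solution when [p] is one of the continuants. *)
Lemma weight_eigenspace (S : {set cube n}) m x (d : nat -> R) :
  (0 < m <= n)%N -> (forall v, (v \in S) = (1 <= weight v <= m)%N) ->
  (forall i, (i < n - m)%N -> d i = 0) -> d (n - m)%N != 0 -> d n = 0 ->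
  (forall i, (n - m <= i < n)%N ->
     (n - i)%:R * d i.+1 = x * d i - i%:R * d i.-1) ->
  \dim (passmx.leigenspace (adj R S) x :&: wspan m) = 1%N.
Proof.
move=> /andP[m_gt0 mn] SE d_lt d_m d_n d_rec.
have vanish f : f \in wspan m -> forall u, u \notin S -> f u = 0.
  by case/weight_spanP => c c0 fc u; rewrite SE fc => /c0.
(* The equation at a vertex of weight n - i; for i = 0 the index n + 1 exceeds every weight, but its
   coefficient is 0. *)
have eig f c : (forall v, f v = c (weight v)) -> f \in wspan m ->
    adj R S f = x *: f <-> forall i, (n - m <= i < n)%N ->
      (n - i)%:R * c (n - i.+1)%N = x * c (n - i)%N - i%:R * c (n - i).+1.
  move=> fc fm; rewrite adj_eigenP; last exact: vanish.
  have flipE v : \sum_i f (flip v i) = (weight v)%:R * c (weight v).-1 +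
      (n - weight v)%:R * c (weight v).+1.
    by rewrite -sum_flip_weight; apply: eq_bigr => i _; rewrite fc.
  split=> [ev i i_n|ev v].
    have := ev (wvec n (n - i)); rewrite SE flipE fc weight_wvec ?leq_subr //.
    rewrite subKn; last by lia.
    rewrite -subnS => <-; [ring | lia].
  rewrite SE flipE fc => v_m; have := ev (n - weight v)%N.
  rewrite subKn; last by lia.
  rewrite (_ : n - (n - weight v).+1 = (weight v).-1)%N; last by lia.
  move=> ->; [ring | lia].
pose f0 : Vcube R n := [ffun v => d (n - weight v)%N].
have f0E v : f0 v = d (n - weight v)%N by rewrite ffunE.
have f0_span : f0 \in wspan m.
  apply/weight_spanP.
  exists (fun j => if (1 <= j <= m)%N then d (n - j)%N else 0).
    by move=> j /negPf->.
  move=> v.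
  rewrite f0E; case: ifP => // /negbT v_m; have := weight_le v.
  have [->|v_gt0] := posnP (weight v); first by rewrite subn0.
  by move=> vn; apply: d_lt; lia.
have f0_eig : adj R S f0 = x *: f0.
  apply/(eig _ (fun k => d (n - k)%N) f0E f0_span) => i i_n.
  rewrite /= !subKn; [|lia..]; rewrite d_rec //.
  by congr (_ - _ * d _); lia.
suff -> : (passmx.leigenspace (adj R S) x :&: wspan m)%VS = <[f0]>%VS.
  rewrite dim_vline (_ : f0 != 0) //; apply: contra_neq d_m => f00.
  have := f0E (wvec n m); rewrite weight_wvec // => <-.
  by rewrite f00 ffunE.
apply/eqP; rewrite eqEsubv; apply/andP; split; last first.
  by rewrite -memvE memv_cap mem_leigenspace f0_eig eqxx.
apply/subvP => f; rewrite memv_cap mem_leigenspace => /andP[/eqP Af fm].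
have /weight_spanP[c c0 fc] := fm; have c_rec := (eig _ _ fc fm).1 Af.
(* Weight m is the highest in the support, so by the downward recurrence an eigenvector is
   determined by its value there. *)
pose t := c m / d (n - m)%N.
have base i : (i <= n - m)%N -> c (n - i)%N = t * d i.
  rewrite leq_eqVlt => /orP[/eqP->|i_m]; first by rewrite subKn // divfK.
  by rewrite d_lt // mulr0; apply: c0; lia.
have step i : (n - m <= i < n)%N -> c (n - i)%N = t * d i ->
    ((0 < i)%N -> c (n - i.-1)%N = t * d i.-1) -> c (n - i.+1)%N = t * d i.+1.
  move=> i_n ci ci1; have ni : (n - i)%:R != 0 :> R.
    by rewrite pnatr_eq0 subn_eq0 -ltnNge; case/andP: i_n.
  apply: (mulfI ni); rewrite c_rec // ci [RHS]mulrCA d_rec //.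
  have [->|i_gt0] := posnP i; first by rewrite !mul0r; ring.
  rewrite (_ : (n - i).+1 = n - i.-1)%N; last by lia.
  by rewrite ci1 //; ring.
have cd i : (i <= n)%N -> c (n - i)%N = t * d i.
  elim/nat_ind2: i => [||i IH0 IH1] i_n; first exact: base.
    have [|nm] := leqP 1 (n - m); first exact: base.
    by apply: step; rewrite ?base //; lia.
  have [|nm] := leqP i.+2 (n - m); first exact: base.
  by apply: step => [||_]; rewrite ?IH1 ?IH0 //; lia.
apply/vlineP; exists t; apply/ffunP => v; rewrite fc ffunE f0E.
by rewrite -[RHS]/(t * d (n - weight v)%N) -cd ?leq_subr // subKn // weight_le.
Qed.

Lemma weight_eq_n v : (weight v == n) = (v == onev n).
Proof.
apply/eqP/eqP => [vn|->]; last first.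
  rewrite /weight -[RHS]card_ord -[RHS]cardsT; apply: eq_card => i.
  by rewrite !inE mxE eqxx.
have /setP v1 : [set i | v 0 i == 1] = setT.
  apply/eqP; rewrite eqEcard subsetT cardsT card_ord /=.
  by rewrite -/(weight v) vn.
by apply/rowP => i; have := v1 i; rewrite !inE mxE => /eqP.
Qed.

Lemma mem_hQ v : (v \in hQ n) = (1 <= weight v <= n)%N.
Proof. by rewrite !inE andbT -weight_eq0 lt0n weight_le andbT. Qed.

Lemma mem_hhQ v : (0 < n)%N -> (v \in hhQ n) = (1 <= weight v <= n.-1)%N.
Proof.
move=> n_gt0; rewrite in_setD1 mem_hQ -weight_eq_n andbC.
have := weight_le v; lia.
Qed.

(** The factor n - i + 1 of the continuant coefficient i (n - i + 1) is absorbed by the factorial in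
    [d i.-1]. *)
Lemma contin_eval (p0 p1 : {poly R}) x i : (0 < i < n)%N ->
  let d j := (contin p0 p1 n j).[x] * (n - j)`!%:R in
  (n - i)%:R * d i.+1 = x * d i - i%:R * d i.-1.
Proof.
case: i => // i /andP[_ i_n] d; rewrite /d /= -/(contin p0 p1 n i.+2).
have [m [e1 e2 e3]] : exists m,
    [/\ (n - i.+2)%N = m, (n - i.+1)%N = m.+1 & (n - i)%N = m.+2].
  by exists (n - i.+2)%N; split; lia.
rewrite continSS hornerD hornerN hornerM hornerX hornerZ e1 e2 e3 !factS !natrM.
ring.
Qed.

Lemma hU_sub_hV : (hU R n <= hV R n)%VS.
Proof.
apply/subvP => f /weight_spanP[c c0 fc]; rewrite memhV fc c0 //.
by rewrite (eqP (_ : weight _ == 0%N)) // weight_eq0.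
Qed.

Lemma hhU_sub_hhV : (0 < n)%N -> (hhU R n <= hhV R n)%VS.
Proof.
move=> n_gt0; apply/subvP => f /weight_spanP[c c0 fc]; rewrite memhhV !fc.
rewrite (eqP (_ : weight (zerov n) == 0%N)) ?weight_eq0 //.
rewrite (eqP (_ : weight (onev n) == n)) ?weight_eq_n //.
by rewrite !c0 ?eqxx //; lia.
Qed.

(** The root condition says that the solution started at weight n vanishes at the deleted weight
    0. *)
Lemma dim_L_eigenspace x : (0 < n)%N -> root (Lpoly R n) x ->
  \dim (L_eigenspace n x) = 1%N.
Proof.
move=> n_gt0; rewrite Lpoly_contin => /rootP px.
apply: (@weight_eigenspace _ n _
  (fun j => (contin 1 'X n j).[x] * (n - j)`!%:R)).
- by rewrite n_gt0 leqnn.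
- exact: mem_hQ.
- by rewrite subnn.
- by rewrite subnn hornerC mul1r pnatr_eq0 -lt0n fact_gt0.
- by rewrite px mul0r.
rewrite subnn => i i_n; have [->|i_gt0] := posnP i.
  rewrite hornerX hornerC subn1 subn0 mul0r subr0 mul1r mulrCA -natrM.
  by rewrite -{1 3}(prednK n_gt0) -factS prednK.
by apply: contin_eval; lia.
Qed.

(** The initial value 0 of [contin 0 1] encodes the deleted weight n, and the root condition the
    deleted weight 0. *)
Lemma dim_M_eigenspace x : (0 < n)%N -> root (Mpoly R n) x ->
  \dim (M_eigenspace n x) = 1%N.
Proof.
move=> n_gt0; rewrite Mpoly_contin // => /rootP px.
(* For n = 1 the polynomial M is the constant 1 and has no root. *)
have n_gt1 : (1 < n)%N.
  rewrite ltn_neqAle n_gt0 andbT; apply: contra_eq_neq px => <-.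
  by rewrite hornerC oner_neq0.
apply: (@weight_eigenspace _ n.-1 _
  (fun j => (contin 0 1 n j).[x] * (n - j)`!%:R)).
- by lia.
- by move=> v; apply: mem_hhQ.
- move=> i i1; rewrite (_ : i = 0%N) ?hornerC ?mul0r //; lia.
- rewrite (_ : (n - n.-1 = 1)%N) ?hornerC ?mul1r; last by lia.
  by rewrite pnatr_eq0 -lt0n fact_gt0.
- by rewrite px mul0r.
by move=> i i_n; apply: contin_eval; lia.
Qed.

End WeightFunctions.

(** * The kernel for even n *)

Section ZeroEigenspace.
Variables (R : realType) (n : nat).
Hypothesis n_gt0 : (0 < n)%N.
Implicit Types (u v w : cube n) (f g : Vcube R n) (s : 'S_n).

Local Notation lam k := (n%:R - (2 * k)%:R : R).

Lemma hhVk_adj_hQ k :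
  (hhVk R n k <= passmx.leigenspace (adj R (hQ n)) (lam k))%VS.
Proof.
apply/subvP => f fk; rewrite mem_leigenspace; apply/eqP/adj_eigenP => [u|w _].
  rewrite !inE andbT negbK => /eqP->.
  by have /subvP/(_ f fk) := hhVk_sub_hhV R n k; rewrite memhhV => /andP[/eqP].
exact: hhVk_sum_flip.
Qed.

Lemma hhV_vanish f u : f \in hhV R n -> u \notin hhQ n -> f u = 0.
Proof.
rewrite memhhV !inE andbT negb_and !negbK => /andP[/eqP f0 /eqP f1].
by case/orP => /eqP->.
Qed.

Lemma hhVk_adj_hhQ k :
  (hhVk R n k <= passmx.leigenspace (adj R (hhQ n)) (lam k))%VS.
Proof.
apply/subvP => f fk; rewrite mem_leigenspace; apply/eqP/adj_eigenP => [u|w _].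
  by apply: hhV_vanish; apply: subvP fk; apply: hhVk_sub_hhV.
exact: hhVk_sum_flip.
Qed.

Lemma fourier_weight_sum (F : nat -> R) u v : weight u = weight v ->
  (\sum_w F (weight w) *: E R w) u = (\sum_w F (weight w) *: E R w) v.
Proof.
move=> uv; have sumE (x : cube n) : (\sum_w F (weight w) *: E R w) x =
    \sum_w F (weight w) * E R x w.
  rewrite sum_ffunE; apply: eq_bigr => w _.
  by rewrite [LHS]ffunE (EC R w).
by rewrite !sumE; apply: sum_weight_E.
Qed.

(** The full operator sends f to a vector supported on the two deleted vertices, where characters
    depend only on the weight. Its Fourier coefficient is [lam] times that of f, and [lam] can be
    cancelled. *)
Lemma hhQ_kernel_fourier f u v : f \in hhV R n -> adj R (hhQ n) f = 0 ->
  weight u = weight v -> lam (weight u) != 0 -> fourier f u = fourier f v.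
Proof.
move=> f_hhV Af uv lam_u.
have Af0 w : w \in hhQ n -> \sum_i f (flip w i) = 0.
  move=> wS; rewrite -(adj_vanishing wS) ?Af ?ffunE // => x.
  exact: hhV_vanish.
have sumE (x : cube n) : \sum_w (\sum_i f (flip w i)) * E R x w =
    \sum_(w in ~: hhQ n) (\sum_i f (flip w i)) * E R x w.
  rewrite [RHS]big_mkcond; apply: eq_bigr => w _; rewrite inE.
  by case: ifPn => //; rewrite negbK => /Af0->; rewrite mul0r.
apply: (mulfI lam_u); rewrite {2}uv -!fourier_sum_flip !sumE.
congr (_ * _); apply: eq_bigr => w; rewrite !inE andbT negb_and !negbK => w01.
by congr (_ * _); case/orP: w01 => /eqP->; rewrite ?E_zerov ?E_onev ?uv.
Qed.

(** Off the middle level the Fourier coefficients of a kernel vector depend only on the weight.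
    Removing the zero-sum part [g] of the middle level makes this true everywhere, and the inverse
    transform of such coefficients is a function of the weight. *)
Lemma hhQ_kernel : ~~ odd n ->
  (passmx.leigenspace (adj R (hhQ n)) 0 :&: hhV R n =
     hhVk R n n./2 + M_eigenspace n (0 : R))%VS.
Proof.
move=> n_even; set k := n./2.
have kn : (n = 2 * k)%N by rewrite /k; lia.
have lam_k : lam k = 0 by rewrite -kn subrr.
apply/eqP; rewrite eqEsubv; apply/andP; split; last first.
  rewrite subv_add; apply/andP; split; last exact/capvS/hhU_sub_hhV.
  by rewrite subv_cap -{1}lam_k hhVk_adj_hhQ hhVk_sub_hhV.
apply/subvP => f; rewrite memv_cap mem_leigenspace scale0r.
case/andP=> /eqP Af f_hhV.
have fourier_w u v : weight u = weight v -> weight u != k ->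
    fourier f u = fourier f v.
  move=> uv uk; apply: hhQ_kernel_fourier => //.
  by rewrite subr_eq0 eqr_nat; apply: contraNneq uk => e; apply/eqP; lia.
pose a := (\sum_(u | weight u == k) fourier f u) /
          #|[pred u : cube n | weight u == k]|%:R.
pose g := \sum_u (if weight u == k then fourier f u - a else 0) *: E R u.
have g_k : g \in hhVk R n k.
  apply: mem_hhVk_sum => [|u /negPf->//|]; first by lia.
  rewrite -big_mkcond sumrB sumr_const -[a *+ _]mulr_natr divfK ?subrr //.
  rewrite pnatr_eq0 -lt0n; apply/card_gt0P; exists (wvec n k).
  by rewrite inE weight_wvec //; lia.
have g_hhV : g \in hhV R n by apply: subvP g_k; apply: hhVk_sub_hhV.
(* The Fourier coefficients of f - g, read off at one representative of each weight. *)
pose F j := if j == k then a else fourier f (wvec n j).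
have fgE : f - g = \sum_u F (weight u) *: E R u.
  rewrite {1}(fourier_inv f) -sumrB; apply: eq_bigr => u _.
  rewrite -scalerBl /F; case: ifPn => uk; first by rewrite subKr.
  by rewrite subr0 (@fourier_w u (wvec n (weight u))) ?weight_wvec ?weight_le.
rewrite -(subrK g f) addrC; apply: memv_add => //.
have fg_hhV : f - g \in hhV R n by rewrite rpredB.
rewrite memv_cap mem_leigenspace linearB /= Af sub0r scale0r oppr_eq0.
have := subvP (hhVk_adj_hhQ k) g g_k.
rewrite lam_k mem_leigenspace scale0r => ->.
apply/weight_spanP.
exists (fun j => if (1 <= j <= n.-1)%N then (f - g) (wvec n j) else 0).
  by move=> j /negPf->.
move=> v; rewrite -mem_hhQ //; case: ifPn => [vS|]; last exact: hhV_vanish.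
rewrite fgE; apply: fourier_weight_sum; rewrite weight_wvec ?weight_le //.
Qed.
End ZeroEigenspace.

Theorem theorem4 (R : realType) (n : nat) (n_gt0 : (0 < n)%N) :
  (* (i) *)
  [/\ simple_real_symmetric_roots (Kpoly R n),
      simple_real_symmetric_roots (Lpoly R n)
    & simple_real_symmetric_roots (Mpoly R n)] /\
  (* (ii) *)
  ((forall x : R, root (Kpoly R n) x <-> passmx.leigenvalue (adj R (Q n)) x) /\
   (forall x : R, passmx.leigenvalue (adj R (Q n)) x <->
      exists2 k : nat, (k <= n)%N & x = n%:R - (2 * k)%:R)) /\
  (* (iii) *)
  strictly_interlaces (root (Lpoly R n)) (root (Kpoly R n)) /\
  (* (iv) *)
  strictly_interlaces (root (Mpoly R n)) (root (Lpoly R n)) /\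
  (* (v) *)
  (strictly_interlaces [pred x | root (Mpoly R n) x & 0 < x]
                       [pred x | root (Kpoly R n) x & 0 < x] /\
   strictly_interlaces [pred x | root (Mpoly R n) x & x < 0]
                       [pred x | root (Kpoly R n) x & x < 0]) /\
  (* (vi) *)
  (forall k : nat, (1 <= k <= n - 1)%N ->
    [/\ (hhVk R n k <= hhV R n)%VS /\ (hhV R n <= hV R n)%VS,
        (hhVk R n k <= passmx.leigenspace (adj R (hQ n)) (n%:R - (2 * k)%:R))%VS,
        (hhVk R n k <= passmx.leigenspace (adj R (hhQ n)) (n%:R - (2 * k)%:R))%VS,
        act_stable (hhVk R n k)
      & rep_iso (add_triv_act (@sub_act R n (hhVk R n k)))
                (@ksubset_perm_act R n k)]) /\
  (* (vii) *)
  ((forall x : R, root (Lpoly R n) x ->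
     [/\ (L_eigenspace n x <= hV R n)%VS,
         \dim (L_eigenspace n x) = 1%N,
         act_trivial (L_eigenspace n x)
       & (L_eigenspace n x :&: \sum_(1 <= k < n) hhVk R n k = 0)%VS]) /\
   (forall x : R, root (Mpoly R n) x ->
     [/\ (M_eigenspace n x <= hhV R n)%VS,
         \dim (M_eigenspace n x) = 1%N,
         act_trivial (M_eigenspace n x)
       & (M_eigenspace n x :&: \sum_(1 <= k < n) hhVk R n k = 0)%VS]) /\
   (~~ odd n ->
     [/\ root (Mpoly R n) 0, n%:R - (2 * n./2)%:R = 0 :> R,
         (passmx.leigenspace (adj R (hhQ n)) 0 :&: hhV R n =
            hhVk R n n./2 + M_eigenspace n (0 : R))%VS
       & directv (hhVk R n n./2 + M_eigenspace n (0 : R))])).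
Proof.
have sum_sub k : (1 <= k < n)%N ->
    (hhVk R n k <= \sum_(1 <= j < n) hhVk R n j)%VS.
  move=> k_n; rewrite (bigD1_seq k) ?iota_uniq ?mem_index_iota //=.
  exact: addvSl.
split; [split|split; [split|split; [|split; [|split; [split|]]]]];
  last (split; [|split; [|split]]).
- apply: (@simple_real_symmetric_all_roots _ _ (nodes R n)).
  + by rewrite size_char_poly size_mkseq.
  + exact/lt_sorted_uniq/nodes_sorted.
  + by apply/allP => x; rewrite mem_nodes.
  + by move=> x; apply: Kpoly_rootN.
- have [b [sb b_sorted b_root _]] := Lpoly_interlacing R n_gt0.
  apply: (@simple_real_symmetric_all_roots _ _ b).
  + by rewrite size_char_poly sb.
  + exact: lt_sorted_uniq.
  + by apply/allP => x; rewrite b_root.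
  + by move=> x; apply: Lpoly_rootN.
- have [b [sb b_sorted b_root b_in]] := Lpoly_interlacing R n_gt0.
  have [c [sc c_sorted c_root _]] :=
    Mpoly_interlacing n_gt0 sb b_sorted b_root b_in.
  apply: (@simple_real_symmetric_all_roots _ _ c).
  + by rewrite size_char_poly sc.
  + exact: lt_sorted_uniq.
  + by apply/allP => x; rewrite c_root.
  + by move=> x; apply: Mpoly_rootN.
- by move=> x; rewrite Kpoly_rootP leigenvalue_hypercube.
- exact: leigenvalue_hypercube.
- have [b [sb b_sorted b_root b_in]] := Lpoly_interlacing R n_gt0.
  exists (nodes R n), b; split=> //; first by split=> //; apply: nodes_sorted.
    exact: mem_nodes.
  by rewrite size_mkseq sb.
- have [b [sb b_sorted b_root b_in]] := Lpoly_interlacing R n_gt0.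
  have [c [sc c_sorted c_root c_in]] :=
    Mpoly_interlacing n_gt0 sb b_sorted b_root b_in.
  by exists b, c; split=> //; rewrite sb sc prednK.
- exact: Mpoly_interlacing_pos.
- exact: Mpoly_interlacing_neg.
- move=> k k_n; split.
  + by split; [apply: hhVk_sub_hhV|apply: capvSl].
  + exact: hhVk_adj_hQ.
  + exact: hhVk_adj_hhQ.
  + exact: hhVk_act_stable.
  + by apply: rep_iso_ksubsets; lia.
- move=> x x_root; split.
  + exact: subv_trans (capvSr _ _) (hU_sub_hV R n).
  + exact: dim_L_eigenspace.
  + by move=> s f; rewrite memv_cap => /andP[_]; apply: weight_span_act.
  + by apply: (@weight_span_capv _ _ n); apply: capvSr.
- move=> x x_root; split.
  + exact: subv_trans (capvSr _ _) (hhU_sub_hhV R n_gt0).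
  + exact: dim_M_eigenspace.
  + by move=> s f; rewrite memv_cap => /andP[_]; apply: weight_span_act.
  + by apply: (@weight_span_capv _ _ n.-1); apply: capvSr.
move=> n_even; split.
- exact: Mpoly_root0.
- by rewrite (_ : (2 * n./2 = n)%N) ?subrr //; lia.
- exact: hhQ_kernel.
(* As n is even and positive, n/2 lies strictly between 0 and n, so the middle space is one of the
   summands that meet the weight functions trivially. *)
have cap0 := @weight_span_capv R n n.-1 (M_eigenspace n 0) (capvSr _ _).
apply/directv_addP/eqP; rewrite -subv0 capvC -cap0.
by apply: capvS => //; apply: sum_sub; lia.
Qed.
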